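(* The ideal $\mathscr{M}=\ker\varphi=\mathscr{HG}(C_0[0,\omega_1))$ is the unique maximal ideal of $\mathscr{B}(C_0[0,\omega_1))$. That is, the Loy--Willis ideal $\mathscr{M}$, the kernel of the Alspach--Benyamini character $\varphi$ and the set $\mathscr{HG}(C_0[0,\omega_1))$ of Hilbert-generated operators on $C_0[0,\omega_1)$ coincide, and this is the unique maximal ideal of $\mathscr{B}(C_0[0,\omega_1))$.
   Context: Scalars are in $\mathbb{K}=\mathbb{R}$ or $\mathbb{K}=\mathbb{C}$. $\omega_1$ is the first uncountable ordinal; ordinal intervals carry the order topology. $C_0[0,\omega_1)$ is the Banach space (supremum norm) of continuous functions $[0,\omega_1)\to\mathbb{K}$ that vanish eventually, and $\mathscr{B}(X)$ is the Banach algebra of bounded operators on $X$. Ideals are two-sided. Loy--Willis ideal: every functional in $C[0,\omega_1]^*$ has a unique representation $\sum_{\gamma\le\omega_1}g(\gamma)\delta_\gamma$ with $\sum_{\gamma\le\omega_1}|g(\gamma)|<\infty$, where $\delta_\gamma$ is the point evaluation at $\gamma$. The matrix of $T\in\mathscr{B}(C[0,\omega_1])$ is defined by $T^*\delta_\beta=\sum_{\gamma\le\omega_1}T_{\beta,\gamma}\delta_\gamma$. The original Loy--Willis ideal of $\mathscr{B}(C[0,\omega_1])$ is the set of $T$ such that the function $\beta\mapsto T_{\beta,\omega_1}$ on $[0,\omega_1]$ is continuous at $\omega_1$; it is a two-sided ideal of codimension one. The Loy--Willis ideal $\mathscr{M}$ of $\mathscr{B}(C_0[0,\omega_1))$ consists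 of those $T$ for which $U^{-1}TU$ belongs to the original Loy--Willis ideal, where $U$ is an isomorphism of $C[0,\omega_1]$ onto $C_0[0,\omega_1)$ (the definition is independent of the choice of $U$). Alspach--Benyamini character: for each $T\in\mathscr{B}(C_0[0,\omega_1))$, $\varphi(T)$ is the unique scalar for which there is a closed and unbounded subset $D$ of $[0,\omega_1)$ with $(Tf)(\alpha)=\varphi(T)f(\alpha)$ for all $f\in C_0[0,\omega_1)$ and $\alpha\in D$; the map $\varphi$ is a character on $\mathscr{B}(C_0[0,\omega_1))$. An operator $T\colon X\to Y$ between Banach spaces is Hilbert-generated if there exist a Hilbert space $H$ and a bounded operator $R\colon H\to Y$ such that $T[X]\subseteq\overline{R[H]}$; $\mathscr{HG}(X,Y)$ is the set of all such operators and $\mathscr{HG}(X)=\mathscr{HG}(X,X)$. *)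

(* Defs.v *)
From HB Require Import structures.
From mathcomp Require Import all_boot all_order all_algebra complex.
From mathcomp Require Import all_classical all_reals all_analysis.
From mathcomp Require summability wochoice.
Set Implicit Arguments.
Unset Strict Implicit.
Unset Printing Implicit Defensive.
Import Order.TTheory GRing.Theory Num.Theory.
Import numFieldNormedType.Exports.
Local Open Scope classical_set_scope.
Local Open Scope ring_scope.

Definition wo : rel (nat -> bool) :=
  sval (wochoice.well_ordering_principle (nat -> bool)).

Lemma wo_min (A : set (nat -> bool)) : A !=set0 ->
  exists2 x, A x & forall y, A y -> wo x y.
Proof.
move=> [a Aa]; pose P : {pred nat -> bool} := [pred x | `[< A x >]].
have [|x [[xP lx] _]] := svalP (wochoice.well_ordering_principle (nat -> bool)) P.
  by exists a; apply/asboolP.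
exists x; first exact/asboolP.
by move=> y Ay; apply: lx; apply/asboolP.
Qed.

Lemma wo_refl : reflexive wo.
Proof.
by move=> x; have [|y -> /(_ x erefl)] := @wo_min [set x]; first by exists x.
Qed.

Lemma wo_total : total wo.
Proof.
move=> x y; have [|z [->|->] h] := @wo_min [set x; y]; first by exists x; left.
  by rewrite (h y)//; right.
by rewrite (h x) ?orbT//; left.
Qed.

Lemma wo_anti : antisymmetric wo.
Proof.
move=> x y /andP[xy yx]; pose P : {pred nat -> bool} := [pred z | (z == x) || (z == y)].
have [|z [_ zu]] := svalP (wochoice.well_ordering_principle (nat -> bool)) P.
  by exists x; rewrite inE eqxx.
have <- : z = x.
  apply: zu; split; first by rewrite inE eqxx.
  by move=> t; rewrite inE => /orP[]/eqP-> //; exact: wo_refl.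
apply: zu; split; first by rewrite inE eqxx orbT.
by move=> t; rewrite inE => /orP[]/eqP-> //; exact: wo_refl.
Qed.

Lemma wo_trans : transitive wo.
Proof.
move=> y x z xy yz; have [|t] := @wo_min [set x; y; z]; first by exists x; left; left.
move=> [[->|->]|->] h.
- by apply: h; right.
- have e : x = y by apply: wo_anti; rewrite xy h//; left; left.
  by rewrite e.
- have e : y = z by apply: wo_anti; rewrite yz h//; left; right.
  by rewrite -e.
Qed.

(* [0, omega_1), cut out of a well-ordering of an uncountable type as the points
   with countably many predecessors. It is determined up to order isomorphism by
   omega1_min, omega1_countable_le and uncountable_omega1. *)
Definition omega1 : Type :=
  {x : nat -> bool | `[< countable [set y | wo y x] >]}.

HB.instance Definition _ := Choice.on omega1.

Fact omega1_display : Order.disp_t. Proof. exact: Order.default_display. Qed.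

Definition le_omega1 (x y : omega1) := wo (sval x) (sval y).

Lemma le_omega1_refl : reflexive le_omega1.
Proof. by move=> x; exact: wo_refl. Qed.

Lemma le_omega1_anti : antisymmetric le_omega1.
Proof. by move=> x y /wo_anti h; apply: val_inj. Qed.

Lemma le_omega1_trans : transitive le_omega1.
Proof. by move=> y x z; exact: wo_trans. Qed.

Lemma le_omega1_total : total le_omega1.
Proof. by move=> x y; exact: wo_total. Qed.

HB.instance Definition _ := Order.Le_isPOrder.Build omega1_display omega1
  le_omega1_refl le_omega1_anti le_omega1_trans.
HB.instance Definition _ :=
  Order.POrder_isTotal.Build omega1_display omega1 le_omega1_total.
HB.instance Definition _ :=
  OrderTopological.copy omega1 (order_topology omega1).

Lemma omega1_min (A : set omega1) : A !=set0 ->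
  exists2 x, A x & forall y, A y -> (x <= y)%O.
Proof.
move=> [a Aa]; have [|_ [x Ax <-] h] := @wo_min (sval @` A).
  by exists (sval a), a.
by exists x => // y Ay; apply: h; exists y.
Qed.

Lemma omega1_countable_le (x : omega1) : countable [set y | (y <= x)%O].
Proof.
have := svalP x => /asboolP/countable_injP[f finj].
apply/countable_injP; exists (f \o sval) => y z /set_mem yx /set_mem zx /= fyz.
by apply: val_inj; apply: finj; rewrite ?inE.
Qed.

Lemma uncountable_omega1 : ~ countable [set: omega1].
Proof.
move=> /countable_injP[f finj].
pose S := [set x | countable [set y | wo y x]].
have cS : countable S.
  pose g x := if pselect (S x) is left Sx
    then f (exist _ x (introT (asboolP _) Sx)) else 0%N.
  apply/countable_injP; exists g => x y /set_mem Sx /set_mem Sy; rewrite /g.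
  case: pselect => // ?; case: pselect => // ? /finj h.
  by have [] := h (mem_set I) (mem_set I).
have [e|/existsNP[x0 nSx0]] := pselect (forall x, S x).
  have /countable_injP[g ginj] : countable [set: nat -> bool].
    by apply: sub_countable cS; apply: subset_card_le => x _; exact: e.
  pose d n := if pselect (exists2 x, g x = n & ~~ x n) is left _ then true else false.
  have : d (g d) = ~~ d (g d); last by case: (d _).
  rewrite {1}/d; case: pselect => [[x /ginj h nx]|].
    by rewrite (h (mem_set I) (mem_set I)) in nx; case: (d _) nx.
  by case dd : (d (g d)) => // n; case: n; exists d => //; rewrite dd.
have [|x nSx xmin] := @wo_min (~` S); first by exists x0.
apply: nSx; rewrite /S/=.
apply: (@sub_countable _ _ _ (\bigcup_(b in [set: bool]) if b then S else [set x])).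
  apply: subset_card_le => y /= yx.
  have [Sy|nSy] := pselect (S y); first by exists true.
  by exists false => //=; apply: wo_anti; rewrite yx xmin.
by apply: bigcup_countable => [//|[] _]; [exact: cS|exact: countable1].
Qed.

(* [0, omega_1], with None as the top element omega_1. *)
Definition omega1c : Type := option omega1.

HB.instance Definition _ := Choice.on omega1c.

Definition omega1_pt : omega1c := None.

Definition le_omega1c (x y : omega1c) := match x, y with
  | _, None => true
  | None, Some _ => false
  | Some x, Some y => (x <= y)%O
  end.

Lemma le_omega1c_refl : reflexive le_omega1c.
Proof. by case=> //= x; exact: lexx. Qed.

Lemma le_omega1c_anti : antisymmetric le_omega1c.
Proof. by case=> [x|] [y|] //= /le_anti ->. Qed.

Lemma le_omega1c_trans : transitive le_omega1c.
Proof. by case=> [x|] [y|] [z|] //=; exact: le_trans. Qed.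

Lemma le_omega1c_total : total le_omega1c.
Proof. by case=> [x|] [y|] //=; exact: le_total. Qed.

HB.instance Definition _ := Order.Le_isPOrder.Build omega1_display omega1c
  le_omega1c_refl le_omega1c_anti le_omega1c_trans.
HB.instance Definition _ :=
  Order.POrder_isTotal.Build omega1_display omega1c le_omega1c_total.
HB.instance Definition _ :=
  OrderTopological.copy omega1c (order_topology omega1c).

Lemma omega1c_min (A : set omega1c) : A !=set0 ->
  exists2 x, A x & forall y, A y -> (x <= y)%O.
Proof.
move=> [a Aa]; have [[x Ax]|n] := pselect (exists x, A (Some x)).
  have [|x' Ax' h] := @omega1_min (Some @^-1` A); first by exists x.
  by exists (Some x') => // -[y|//]; exact: h.
exists None => [|[y|//] Ay]; last by case: n; exists y.
by case: a Aa => // x Ax; case: n; exists x.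
Qed.

Lemma omega1_nonempty : [set: omega1] !=set0.
Proof.
by apply/set0P/eqP => e; apply: uncountable_omega1; rewrite e; exact: countable0.
Qed.

Lemma continuous_bounded_le d (T : orderTopologicalType d) (K : numFieldType)
    (f : T -> K) :
  (forall A : set T, A !=set0 -> exists2 x, A x & forall y, A y -> (x <= y)%O) ->
  continuous f ->
  forall x, exists M, forall y, (y <= x)%O -> `|f y| <= M.
Proof.
move=> wfT fc; apply: contrapT => /existsNP[a Ha].
have [|x nx xmin] := @wfT [set x | ~ exists M, forall y, (y <= x)%O -> `|f y| <= M].
  by exists a.
apply: nx.
have : nbhs x [set y | `|f x - f y| < 1].
  by have /cvgrPdist_lt/(_ 1 ltr01) := fc x.
rewrite itv_nbhsE => -[i [iopen xi] isub].
have bnd y : y \in i -> `|f y| <= `|f x| + 1.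
  move=> /isub /= /ltW h; rewrite -[f y](subKr (f x)).
  by rewrite (le_trans (ler_normB _ _))// lerD2l.
case: i iopen xi isub bnd => -[bl l|[]] u iopen xi isub bnd //.
- have lx : (l < x)%O.
    move: xi; rewrite itv_boundlr => /andP[+ _].
    by move/itv_open_ends_lside: iopen => ->; rewrite bnd_simp.
  have [M HM] : exists M, forall y, (y <= l)%O -> `|f y| <= M.
    apply: contrapT => n; have /xmin : [set x | ~ exists M, forall y, (y <= x)%O -> `|f y| <= M] l by [].
    by rewrite leNgt lx.
  exists (`|M| + (`|f x| + 1)) => y yx.
  have [yl|ly] := leP y l.
    rewrite (le_trans (HM _ yl))// (le_trans (real_ler_norm _))//.
      by rewrite realE (le_trans _ (HM _ yl)).
    by rewrite lerDl addr_ge0.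
  rewrite (@le_trans _ _ (`|f x| + 1))// ?lerDr//; apply: bnd.
  move: xi; rewrite !itv_boundlr => /andP[_ xu]; apply/andP; split.
    by move/itv_open_ends_lside: iopen => ->; rewrite bnd_simp.
  by apply: le_trans xu; rewrite bnd_simp.
- exists (`|f x| + 1) => y yx; apply: bnd.
  move: xi; rewrite !itv_boundlr => /andP[_ xu]; apply/andP; split => //.
  by apply: le_trans xu; rewrite bnd_simp.
Qed.

Variant scalars := RealScalars | ComplexScalars.

Section Scalars.
Variables (R : realType) (k : scalars).

Definition base_field : numFieldType :=
  match k with RealScalars => R | ComplexScalars => R[i] end.

Definition of_real : R -> base_field :=
  match k return R -> match k with RealScalars => R : numFieldType
                                 | ComplexScalars => R[i] end with
  | RealScalars => fun x => x
  | ComplexScalars => fun x => (x%:C)%C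
  end.

Definition modulus : base_field -> R :=
  match k return match k with RealScalars => R : numFieldType
                            | ComplexScalars => R[i] end -> R with
  | RealScalars => fun x => `|x|
  | ComplexScalars => fun z => complex.Re `|z|
  end.

Definition conj_scalar : {rmorphism base_field -> base_field} :=
  match k return
    let K : numFieldType := match k with RealScalars => R
                            | ComplexScalars => R[i] end in
    {rmorphism K -> K} with
  | RealScalars => idfun
  | ComplexScalars => Num.conj
  end.

End Scalars.
Arguments of_real {R} k x.
Arguments modulus {R k} z.
Arguments conj_scalar : clear implicits.

Section ScalarsTheory.
Variables (R : realType) (k : scalars).
Local Notation K := (base_field R k).

Lemma le_of_real (x y : R) : (of_real k x <= of_real k y) = (x <= y).
Proof. by case: k => //=; rewrite lecR. Qed.

Lemma of_real_modulus (z : K) : of_real k (modulus z) = `|z|.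
Proof. by move: z; rewrite /modulus /of_real /base_field; case: k. Qed.

End ScalarsTheory.

Section SupNorm.
Variables (X : Type) (R : realType) (k : scalars).
Local Notation K := (base_field R k).
Implicit Type f : X -> K.

(* A norm over a numFieldType K takes its values in K, hence the embedding of the
   real supremum by of_real. *)
Definition sup_norm f : K := of_real k (sup (range (modulus \o f))).

Hypothesis X0 : [set: X] !=set0.

Let bounded f := exists M, forall x, `|f x| <= M.

Lemma ge_sup_norm f M : (forall x, `|f x| <= M) -> sup_norm f <= M.
Proof.
move=> fM; have [x0 _] := X0.
have M0 : 0 <= M by rewrite (le_trans _ (fM x0)).
rewrite -[M]ger0_norm// -of_real_modulus le_of_real.
apply: ge_sup; first by exists (modulus (f x0)), x0.
move=> _ [x _ <-] /=; rewrite -(le_of_real k) !of_real_modulus.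
by rewrite (ger0_norm M0).
Qed.

Lemma le_sup_norm f x : bounded f -> `|f x| <= sup_norm f.
Proof.
move=> [M fM]; rewrite -of_real_modulus le_of_real.
apply: ub_le_sup; last by exists x.
exists (modulus M) => _ [y _ <-] /=; rewrite -(le_of_real k) !of_real_modulus.
by rewrite (@ger0_norm _ M)// (le_trans _ (fM x)).
Qed.

Lemma ler_sup_normD f g : bounded f -> bounded g ->
  sup_norm (f + g) <= sup_norm f + sup_norm g.
Proof.
move=> bf bg; apply: ge_sup_norm => x.
by rewrite (le_trans (ler_normD _ _))// lerD// le_sup_norm.
Qed.

Lemma sup_normZ (l : K) f : bounded f -> sup_norm (l *: f) = `|l| * sup_norm f.
Proof.
move=> bf; have h : sup_norm (l *: f) <= `|l| * sup_norm f.
  by apply: ge_sup_norm => x; rewrite normrM ler_wpM2l// le_sup_norm.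
apply/le_anti; rewrite h/=.
have blf : bounded (l *: f).
  by exists (`|l| * sup_norm f) => x; rewrite normrM ler_wpM2l// le_sup_norm.
have [x0 _] := X0.
have [->|l0] := eqVneq l 0.
  by rewrite normr0 mul0r (le_trans _ (le_sup_norm x0 _))// scale0r; exists 0 => x; rewrite normr0.
rewrite -ler_pdivlMl ?normr_gt0//; apply: ge_sup_norm => x.
by rewrite ler_pdivlMl ?normr_gt0// -normrM; exact: (le_sup_norm x blf).
Qed.

Lemma sup_norm_eq0 f : bounded f -> sup_norm f = 0 -> f = 0.
Proof.
move=> bf f0; apply/funext => x; apply/eqP.
by rewrite -normr_le0 -f0 le_sup_norm.
Qed.

End SupNorm.

Section ContinuousFunctions.
Variables (R : realType) (k : scalars).
Local Notation K := (base_field R k).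

Definition C_pred : {pred omega1c -> K} := [pred f | `[< continuous f >]].

Lemma C_submod_closed : submod_closed C_pred.
Proof.
split; first by apply/asboolP; apply: (@cst_continuous _ K 0).
move=> a f g /asboolP fc /asboolP gc; apply/asboolP => x.
by apply: continuousD; [apply: (@continuousZl_tmp K K); exact: fc|exact: gc].
Qed.

HB.instance Definition _ :=
  GRing.isSubmodClosed.Build K (omega1c -> K) C_pred C_submod_closed.

Record C_omega1c := MkC { C_fun :> omega1c -> K; _ : C_fun \in C_pred }.

HB.instance Definition _ := [isSub for C_fun].
HB.instance Definition _ := [Choice of C_omega1c by <:].
HB.instance Definition _ := [SubChoice_isSubLmodule of C_omega1c by <:].

Lemma C_continuous (f : C_omega1c) : continuous f.
Proof. by case: f => f /= /asboolP. Qed.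

Lemma C_bounded (f : C_omega1c) : exists M, forall x, `|f x| <= M.
Proof.
have [M fM] := continuous_bounded_le omega1c_min (@C_continuous f) omega1_pt.
by exists M => x; apply: fM; case: x.
Qed.

Definition C_norm (f : C_omega1c) : K := sup_norm f.

Let omega1c_nonempty : [set: omega1c] !=set0. Proof. by exists omega1_pt. Qed.

Lemma ler_C_normD f g : C_norm (f + g) <= C_norm f + C_norm g.
Proof. exact: ler_sup_normD (C_bounded f) (C_bounded g). Qed.

Lemma C_normZ l f : C_norm (l *: f) = `|l| * C_norm f.
Proof. exact: sup_normZ (C_bounded f). Qed.

Lemma C_norm_eq0 f : C_norm f = 0 -> f = 0.
Proof. by move=> /(sup_norm_eq0 (C_bounded f)) h; apply: val_inj. Qed.

HB.instance Definition _ := Lmodule_isNormed.Build K C_omega1c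
  ler_C_normD C_normZ C_norm_eq0.

End ContinuousFunctions.

Section VanishingFunctions.
Variables (R : realType) (k : scalars).
Local Notation K := (base_field R k).

Definition C0_pred : {pred omega1 -> K} := [pred f |
  `[< continuous f /\ exists a, forall b, (a <= b)%O -> f b = 0 >]].

Lemma C0_submod_closed : submod_closed C0_pred.
Proof.
split.
  have [a _] := omega1_nonempty.
  by apply/asboolP; split; [apply: (@cst_continuous _ K 0)|exists a].
move=> c f g /asboolP[fc [a fa]] /asboolP[gc [b gb]]; apply/asboolP; split.
  by move=> x; apply: continuousD; [apply: (@continuousZl_tmp K K); exact: fc|exact: gc].
exists (Order.max a b) => x; rewrite ge_max => /andP[/fa fx /gb gx].
by rewrite -[LHS]/(c *: f x + g x) fx gx scaler0 addr0.
Qed.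

HB.instance Definition _ :=
  GRing.isSubmodClosed.Build K (omega1 -> K) C0_pred C0_submod_closed.

Record C0_omega1 := MkC0 { C0_fun :> omega1 -> K; _ : C0_fun \in C0_pred }.

HB.instance Definition _ := [isSub for C0_fun].
HB.instance Definition _ := [Choice of C0_omega1 by <:].
HB.instance Definition _ := [SubChoice_isSubLmodule of C0_omega1 by <:].

Lemma C0_bounded (f : C0_omega1) : exists M, forall x, `|f x| <= M.
Proof.
case: f => f /= /asboolP[fc [a fa]].
have [M fM] := continuous_bounded_le omega1_min fc a.
exists M => x; have [/fM//|/ltW/fa ->] := leP x a.
by rewrite normr0 (le_trans _ (fM _ (lexx a))).
Qed.

Definition C0_norm (f : C0_omega1) : K := sup_norm f.

Lemma ler_C0_normD f g : C0_norm (f + g) <= C0_norm f + C0_norm g.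
Proof. exact: (ler_sup_normD omega1_nonempty) (C0_bounded f) (C0_bounded g). Qed.

Lemma C0_normZ l f : C0_norm (l *: f) = `|l| * C0_norm f.
Proof. exact: (sup_normZ omega1_nonempty) (C0_bounded f). Qed.

Lemma C0_norm_eq0 f : C0_norm f = 0 -> f = 0.
Proof. by move=> /(sup_norm_eq0 (C0_bounded f)) h; apply: val_inj. Qed.

HB.instance Definition _ := Lmodule_isNormed.Build K C0_omega1
  ler_C0_normD C0_normZ C0_norm_eq0.

End VanishingFunctions.

Section Operators.
Variables (K : numFieldType) (X Y : normedModType K).

Definition bop_pred : {pred X -> Y} := [pred T |
  `[< linear T /\ exists M, forall x, `|T x| <= M * `|x| >]].

Lemma bop_submod_closed : submod_closed bop_pred.
Proof.
split.
  apply/asboolP; split; last by exists 0 => x; rewrite normr0 mul0r.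
  by move=> a x y; rewrite /= scaler0 addr0.
move=> c S T /asboolP[Sl [M SM]] /asboolP[Tl [N TN]]; apply/asboolP; split.
  move=> a x y; rewrite -[LHS]/(c *: S _ + T _) Sl Tl.
  rewrite -[RHS]/(a *: (c *: S x + T x) + (c *: S y + T y)).
  by rewrite !scalerDr !scalerA mulrC addrACA.
exists (`|c| * M + N) => x; rewrite mulrDl -mulrA.
rewrite (le_trans (ler_normD (c *: S x) (T x)))// lerD// normrZ.
by rewrite ler_wpM2l.
Qed.

HB.instance Definition _ :=
  GRing.isSubmodClosed.Build K (X -> Y) bop_pred bop_submod_closed.

Record bop := MkBop { bop_fun :> X -> Y; _ : bop_fun \in bop_pred }.

HB.instance Definition _ := [isSub for bop_fun].
HB.instance Definition _ := [Choice of bop by <:].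
HB.instance Definition _ := [SubChoice_isSubLmodule of bop by <:].

Lemma bop_linear (T : bop) : linear T.
Proof. by case: T => T /= /asboolP[]. Qed.

HB.instance Definition _ (T : bop) :=
  GRing.isLinear.Build K X Y *:%R T (bop_linear T).

Lemma bop_bounded (T : bop) : exists M, forall x, `|T x| <= M * `|x|.
Proof. by case: T => T /= /asboolP[]. Qed.

End Operators.
Arguments bop_pred {K} X Y.

Notation "''B' ( X , Y )" := (bop X%type Y%type)
  (at level 8, format "''B' ( X ,  Y )") : type_scope.
Notation "''B' ( X )" := (bop X%type X%type)
  (at level 8, format "''B' ( X )") : type_scope.

Section Composition.
Variables (K : numFieldType) (X Y Z : normedModType K).

Lemma bcomp_subproof (S : 'B(Y, Z)) (T : 'B(X, Y)) : S \o T \in bop_pred X Z.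
Proof.
apply/asboolP; split; first by move=> a x y; rewrite /= !linearP.
have [M SM] := bop_bounded S; have [N TN] := bop_bounded T.
exists (`|M| * N) => x; rewrite /= (le_trans (SM _))// -mulrA.
have := SM (T x); have [->|Tx0 STx] := eqVneq (T x) 0.
  by rewrite normr0 mulr0 => _; rewrite mulr_ge0// (le_trans _ (TN x)).
have M0 : 0 <= M.
  by rewrite -(@pmulr_lge0 _ `|T x|) ?normr_gt0// (le_trans _ STx).
by rewrite ger0_norm// ler_wpM2l.
Qed.

Definition bcomp S T : 'B(X, Z) := MkBop (bcomp_subproof S T).

End Composition.

Section Ideals.
Variables (K : numFieldType) (X : normedModType K).
Implicit Type I J : set 'B(X).

Definition ideal I := [/\ I 0,
  forall S T, I S -> I T -> I (S + T),
  forall c T, I T -> I (c *: T) &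
  forall S T, I T -> I (bcomp S T) /\ I (bcomp T S)].

Definition maximal_ideal I := [/\ ideal I, I <> setT &
  forall J, ideal J -> I `<=` J -> J = I \/ J = setT].

End Ideals.

Section HilbertGenerated.
Variables (R : realType) (k : scalars).
Local Notation K := (base_field R k).

(* In {dot H for theta}, theta is the scaling of the second argument. *)
Definition hilbert_norm (H : normedModType K) :=
  exists ip : {dot H for conj_scalar R k}, forall h, `|h| ^+ 2 = ip h h.

Definition hilbert_generated (X Y : normedModType K) : set 'B(X, Y) :=
  [set T | exists H : completeNormedModType K, hilbert_norm H /\
    exists S : 'B(H, Y), range T `<=` closure (range S)].

End HilbertGenerated.
Arguments hilbert_generated {R k} X Y.

Section LoyWillis.
Variables (R : realType) (k : scalars).
Local Notation K := (base_field R k).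
Local Notation C := (C_omega1c R k).
Local Notation C0 := (C0_omega1 R k).

Lemma eval_at_subproof (b : omega1c) :
  (fun f : C => f b : K^o) \in bop_pred C K^o.
Proof.
apply/asboolP; split=> //; exists 1 => f; rewrite mul1r.
exact: le_sup_norm (C_bounded f).
Qed.

Definition eval_at (b : omega1c) : 'B(C, K^o) := MkBop (eval_at_subproof b).

Definition adjoint (T : 'B(C)) (mu : 'B(C, K^o)) : 'B(C, K^o) := bcomp mu T.

(* The functional mu is \sum_c g c *: delta_c. As g is absolutely summable, the
   unordered series converges in norm to mu as soon as it does so pointwise. *)
Definition represents (g : omega1c -> K) (mu : 'B(C, K^o)) :=
  summable setT (fun c => (modulus (g c))%:E) /\
  forall f : C, summability.partial_sum (fun c => g c *: eval_at c f)
    @ summability.totally --> mu f.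

(* The coefficients of T^* delta_b; each functional on C[0, omega_1] has exactly
   one representation, so the default value of xget is immaterial. *)
Definition op_matrix (T : 'B(C)) (b : omega1c) : omega1c -> K :=
  xget (fun=> 0) [set g | represents g (adjoint T (eval_at b))].

Definition loy_willis_C : set 'B(C) :=
  [set T | {for omega1_pt, continuous (fun b => op_matrix T b omega1_pt)}].

(* Isomorphisms U with inverse V exist, and any of them yields the same set. *)
Definition loy_willis : set 'B(C0) :=
  [set T | exists (U : 'B(C, C0)) (V : 'B(C0, C)),
    [/\ cancel U V, cancel V U & loy_willis_C (bcomp V (bcomp T U))]].

End LoyWillis.

Section AlspachBenyamini.
Variables (R : realType) (k : scalars).
Local Notation K := (base_field R k).
Local Notation C0 := (C0_omega1 R k).

Definition club (D : set omega1) :=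
  closed D /\ forall a, exists2 b, D b & (a <= b)%O.

(* Exactly one scalar c has the required property, so the default value of xget
   is immaterial. *)
Definition ab_character (T : 'B(C0)) : K :=
  xget 0 [set c | exists D, club D /\
    forall (f : C0) a, D a -> T f a = c * f a].

End AlspachBenyamini.
Arguments loy_willis : clear implicits.
Arguments ab_character {R k} T.

(* Main.v *)
(** The functional [f |-> T f b] is a measure, and a measure on a scattered ordinal
    is purely atomic: its atom at x is the limit of its values on the intervals
    (o, x] as o increases to x. In particular [T 1_[0,a]] is, at each fixed point b,
    eventually constant in a; the eventual value is continuous in b, hence eventually
    a constant c, and a closing-off argument gives a club on which [T f = c f].
    The Loy-Willis condition is read off from the same eventual values.

    If c <> 0, collapsing [0, omega_1) onto that club (which is order isomorphic to
    [0, omega_1)) factors the identity through T, so every proper ideal lies in the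
    kernel of the character. A Hilbert-generated T cannot have c <> 0: bounded
    approximate preimages of the functions [T 1_[0,a]], for a increasing to a point of
    the club, would have a weak cluster point whose image jumps there. If c = 0, the
    range of T vanishes on a club; the gaps of the club are countable, so suitably
    weighted indicators of intervals inside the gaps are the images of the unit
    vectors under a bounded operator on l_2(omega_1) whose range is dense in the
    functions vanishing on the club. *)
From HB Require Import structures.
Require Import Defs.
From mathcomp Require Import all_boot all_order all_algebra complex finmap.
From mathcomp Require Import all_classical all_reals all_analysis.
From mathcomp Require Import ring lra.
From mathcomp Require summability.
Set Implicit Arguments.
Unset Strict Implicit.
Unset Printing Implicit Defensive.
Import Order.TTheory GRing.Theory Num.Theory.
Import numFieldNormedType.Exports.
Local Open Scope classical_set_scope.
Local Open Scope ring_scope.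

(** * Scalars *)

(** Real and complex scalars are treated at once. Norms take values in [K], whose order is only
    partial when [K] is complex, so order arguments pass to [R] through [modulus] or carry realness
    side conditions. No integral representation theorem is assumed. The atoms of a functional are
    limits along a Cauchy filter, a bounded-variation estimate makes them summable, and transfinite
    induction shows that a functional without atoms is zero. Two facts about well-orders drive most
    steps. A point that is not maximal has an immediate successor, so continuity and closedness are
    tested from the left only. And countably many thresholds in [0, omega_1) have a common bound;
    this turns closeness up to every 1/(n+1) on some tail into equality on one tail, and it yields a
    single norm bound for unboundedly many approximate preimages. Weak topologies are avoided: the
    conditions imposed on the cluster point are convex, closed and nested, and the parallelogram law
    produces a point satisfying all of them. *)

Section Scalars.
Variables (R : realType) (k : scalars).
Local Notation K := (base_field R k).

Lemma of_realD (x y : R) : of_real k (x + y) = of_real k x + of_real k y.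
Proof. by case: k => //=; rewrite rmorphD. Qed.

Lemma of_real0 : of_real k (0 : R) = 0.
Proof. by case: k. Qed.

Lemma of_real1 : of_real k (1 : R) = 1.
Proof. by case: k. Qed.

Lemma of_realM (x y : R) : of_real k (x * y) = of_real k x * of_real k y.
Proof. by case: k => //=; rewrite rmorphM. Qed.

Lemma of_real_sum I (r : seq I) (P : pred I) (F : I -> R) :
  of_real k (\sum_(i <- r | P i) F i) = \sum_(i <- r | P i) of_real k (F i).
Proof. by apply: (big_morph (of_real k)); [exact: of_realD|exact: of_real0]. Qed.

Lemma lt_of_real (x y : R) : (of_real k x < of_real k y) = (x < y).
Proof. by case: k => //=; rewrite ltcR. Qed.

Lemma modulus_ge0 (z : K) : 0 <= modulus z.
Proof. by rewrite -(le_of_real k) of_real_modulus of_real0. Qed.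

Lemma modulus0 : modulus (0 : K) = 0.
Proof.
by apply/le_anti; rewrite modulus_ge0 -(le_of_real k) of_real_modulus normr0 of_real0 lexx.
Qed.

Lemma of_realK (x : R) : 0 <= x -> modulus (of_real k x) = x.
Proof.
move=> x0; apply/le_anti; rewrite -!(le_of_real k) !of_real_modulus.
by rewrite ger0_norm ?lexx// -of_real0 le_of_real.
Qed.

Lemma modulusK (z : K) : 0 <= z -> of_real k (modulus z) = z.
Proof. by rewrite of_real_modulus => /ger0_norm. Qed.

Lemma modulusD (x y : K) : modulus (x + y) <= modulus x + modulus y.
Proof. by rewrite -(le_of_real k) of_realD !of_real_modulus ler_normD. Qed.

Lemma modulusM (x y : K) : modulus (x * y) = modulus x * modulus y.
Proof.
apply/le_anti; rewrite -!(le_of_real k) of_realM !of_real_modulus normrM.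
by rewrite lexx.
Qed.

Lemma le_modulus (x y : K) : (modulus x <= modulus y) = (`|x| <= `|y|).
Proof. by rewrite -(le_of_real k) !of_real_modulus. Qed.

(** A positive element of [K] is the image of its modulus, so the Archimedean property is pulled
    back from [R], also when [K] is complex. *)
Lemma archi_inv (e : K) : 0 < e -> exists n : nat, n.+1%:R^-1 < e.
Proof.
move=> e0; have m0 : 0 < modulus e.
  by rewrite -lt_of_real of_real0 modulusK// ltW.
exists (Num.bound (modulus e)^-1); set n := Num.bound _.
have h : (modulus e)^-1 < n.+1%:R.
  rewrite (lt_trans (archi_boundP _))// ?invr_ge0 ?ltW//.
  by rewrite ltr_nat.
rewrite invf_plt// ?posrE ?ltr0n// -(modulusK (ltW e0)).
have -> : (of_real k (modulus e))^-1 = of_real k (modulus e)^-1.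
  apply: (mulfI (x := of_real k (modulus e))).
    by rewrite modulusK ?ltW// gt_eqF.
  by rewrite -of_realM !divff ?of_real1// ?modulusK ?ltW// gt_eqF.
have -> : n.+1%:R = of_real k n.+1%:R :> K.
  by elim: (n.+1) => [|m IH]; rewrite ?of_real0// -!natr1 of_realD IH of_real1.
by rewrite lt_of_real.
Qed.

Lemma norm_small0 (x : K) : (forall n : nat, `|x| <= n.+1%:R^-1) -> x = 0.
Proof.
move=> h; apply/eqP/negPn/negP; rewrite -normr_gt0 => /archi_inv[n].
by rewrite real_ltNge ?h// ?normr_real// gtr0_real.
Qed.

(** Realness makes [x] and [y] comparable; then half of a positive difference [x - y] is a
    contradictory choice of [e]. *)
Lemma le_eps (x y : K) : x \is Num.real -> y \is Num.real ->
  (forall e, 0 < e -> x <= y + e) -> x <= y.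
Proof.
move=> xr yr h; rewrite real_leNgt//; apply/negP => yx.
have d0 : 0 < (x - y) / 2 by rewrite divr_gt0 ?subr_gt0.
have := h _ d0; rewrite -lerBlDl real_leNgt ?rpredB//; last by rewrite gtr0_real.
by rewrite ltr_pdivrMr// ltr_pMr ?subr_gt0// ltr1n.
Qed.

(** In the complex case the real and imaginary parts do not increase the modulus, so both image
    filters are Cauchy in [R] and their limits recombine. Atoms, unordered sums and coordinates of
    limits in [l2] all come from here. *)
Lemma base_field_complete (F : set_system K) : ProperFilter F ->
  (forall e : K, 0 < e -> exists x, F [set y | `|x - y| < e]) ->
  exists l : K, F --> l.
Proof.
case: k F => /= F FF HF.
  have /cauchy_cvg : cauchy F.
    apply/cauchy_exP => e e0; have [x Fx] := HF e e0.
    by exists x.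
  by move=> h; exists (lim F).
have ReIm_le (z : R[i]) : (`|complex.Re z|%R)%:C%C <= `|z| /\ (`|complex.Im z|%R)%:C%C <= `|z|.
  case: z => a b /=; rewrite normc_def /= !lecR; split.
    by rewrite -sqrtr_sqr ler_wsqrtr// lerDl sqr_ge0.
  by rewrite -sqrtr_sqr ler_wsqrtr// lerDr sqr_ge0.
have key (p : R[i] -> R) : (forall z, `|p z|%R%:C%C <= `|z|) ->
    {morph p : x y / x - y} -> exists l : R, p @ F --> l.
  move=> pn pB; have /cauchy_cvg : cauchy (p @ F).
    apply/cauchy_exP => e e0; have [|x Fx] := HF (e%:C%C); first by rewrite ltcR.
    exists (p x); rewrite nbhs_simpl.
    suff : F [set y : R[i] | `|p x - p y| < e] by [].
    apply: (filterS _ Fx) => y /= xy.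
    by rewrite -ltcR -pB; apply: le_lt_trans xy; exact: pn.
  by move=> h; exists (lim (p @ F)).
have [a Fa] := key _ (fun z => (ReIm_le z).1) (raddfB (@complex.Re R)).
have [b Fb] := key _ (fun z => (ReIm_le z).2) (raddfB (@complex.Im R)).
exists (a +i* b)%C.
have [_] := @fcvgrPdist_lt _ (base_field R ComplexScalars) F FF (a +i* b)%C.
apply => e e0.
have e0' : 0 < complex.Re e /\ complex.Im e = 0.
  by move: e0; case: (e) => x y; rewrite ltcE /= => /andP[/eqP].
have e2 : 0 < complex.Re e / 2 by rewrite divr_gt0// e0'.1.
have /cvgrPdist_lt/(_ _ e2) Fa' := Fa.
have /cvgrPdist_lt/(_ _ e2) Fb' := Fb.
near=> z.
have za : `|a - complex.Re z| < complex.Re e / 2 by near: z.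
have zb : `|b - complex.Im z| < complex.Re e / 2 by near: z.
have -> : ((a +i* b)%C - z = (a - complex.Re z)%:C + 'i * (b - complex.Im z)%:C)%C.
  by case: (z) => x y; simpc.
rewrite (le_lt_trans (ler_normD _ _))// normrM !normc_def /= !expr0n /= !addr0.
rewrite add0r expr1n sqrtr1 mul1r !sqrtr_sqr.
have -> : e = (complex.Re e / 2)%:C%C + (complex.Re e / 2)%:C%C.
  by rewrite -rmorphD /= -splitr; case: (e) e0' => x y /= [_ ->].
by rewrite ltrD// ltcR.
Unshelve. all: by end_near.
Qed.

End Scalars.

(** * Finite sums and unordered series *)

Section FiniteSums.
Variables (I : choiceType) (V : zmodType).
Implicit Types (A B : {fset I}) (f : I -> V).

Lemma sum_fsetD A B f : (A `<=` B)%fset ->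
  \sum_(i <- B) f i = \sum_(i <- A) f i + \sum_(i <- (B `\` A)%fset) f i.
Proof.
move=> AB; rewrite (big_fsetID _ (mem A)) /=; congr (_ + _).
  apply: eq_fbigl => i; rewrite !inE /=; case iA : (i \in A); rewrite ?andbF//.
  by rewrite (fsubsetP AB).
by apply: eq_fbigl => i; rewrite !inE /= andbC.
Qed.

Lemma sum_fsetU A B f : [disjoint A & B]%fset ->
  \sum_(i <- (A `|` B)%fset) f i = \sum_(i <- A) f i + \sum_(i <- B) f i.
Proof.
move=> /fdisjointP_sym AB; rewrite (@sum_fsetD A) ?fsubsetUl//; congr (_ + _).
apply: eq_fbigl => i; rewrite !inE; case iA : (i \in A) => //=.
by apply/esym/negbTE/negP => /AB; rewrite iA.
Qed.

End FiniteSums.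

#[local] Existing Instance summability.totally_filter.

Section NetSums.
Variables (R : realType) (k : scalars) (I : choiceType).
Local Notation K := (base_field R k).
Implicit Types (A B : {fset I}).

Definition net_sum (g : I -> K) (s : K) :=
  summability.partial_sum g @ summability.totally --> s.

Lemma net_sumP (g : I -> K) s : net_sum g s <->
  forall e, 0 < e -> exists A, forall B, (A `<=` B)%fset ->
    `|s - \sum_(i <- B) g i| < e.
Proof.
split=> [/cvgrPdist_lt h e e0|h].
  have [A _ AP] := h e e0; exists A => B AB.
  by have := AP B AB; rewrite /= /summability.partial_sum -(big_seq_fsetE _ _ xpredT).
apply/cvgrPdist_lt => e e0; have [A AP] := h e e0.
exists A => // B AB; have := AP B AB.
by rewrite /= /summability.partial_sum -(big_seq_fsetE _ _ xpredT).
Qed.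

Lemma net_sum_unique (g : I -> K) s t : net_sum g s -> net_sum g t -> s = t.
Proof.
by move=> gs gt; apply: (cvg_unique _ gs gt); exact: norm_hausdorff.
Qed.

Lemma net_sumD (g h : I -> K) s t : net_sum g s -> net_sum h t ->
  net_sum (g \+ h) (s + t).
Proof.
move=> gs ht; rewrite /net_sum.
have -> : summability.partial_sum (g \+ h) =
    summability.partial_sum g \+ summability.partial_sum h.
  by apply/funext => A; rewrite /summability.partial_sum /= big_split.
exact: cvgD.
Qed.

Lemma net_sumZ (c : K) (g : I -> K) s : net_sum g s ->
  net_sum (fun i => c * g i) (c * s).
Proof.
move=> gs; rewrite /net_sum.
have -> : summability.partial_sum (fun i => c * g i) =
    (fun A => c * summability.partial_sum g A).
  by apply/funext => A; rewrite /summability.partial_sum /= mulr_sumr.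
exact: cvgMr.
Qed.

Lemma net_sum_norm_le (g : I -> K) s M : net_sum g s ->
  (exists A, forall B, (A `<=` B)%fset -> `|\sum_(i <- B) g i| <= M) -> `|s| <= M.
Proof.
move=> /net_sumP gs [A gM].
have M0 : M \is Num.real by rewrite ger0_real// (le_trans _ (gM A (fsubset_refl _))).
apply: le_eps => //.
move=> e /gs[B BP]; have AB := fsubsetUl A B.
have := BP _ (fsubsetUr A B); move: (gM _ AB); set S := bigop.body _ _ _ => SM sS.
by rewrite -[s](subrK S) addrC (le_trans (ler_normD _ _))// lerD// ltW.
Qed.

(** A finite set whose sum is within [e] of the supremum leaves less than [e] to any set disjoint
    from it. *)
Lemma tail_lt (a : I -> R) M : (forall i, 0 <= a i) ->
  (forall A, \sum_(i <- A) a i <= M) ->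
  forall e, 0 < e -> exists A, forall B, [disjoint A & B]%fset ->
    \sum_(i <- B) a i < e.
Proof.
move=> a0 aM e e0; pose S := [set \sum_(i <- A) a i | A in [set: {fset I}]].
have hS : has_sup S.
  split; first by exists (\sum_(i <- fset0) a i), fset0.
  by exists M => _ [A _ <-].
have [_ [A _ <-] SA] := sup_adherent e0 hS.
exists A => B AB; have : \sum_(i <- (A `|` B)%fset) a i <= sup S.
  by apply: sup_upper_bound => //; exists (A `|` B)%fset.
by rewrite sum_fsetU// => h; rewrite -(ltrD2l (sup S - e)) subrK (lt_le_trans _ h)// ltrD2r.
Qed.

Lemma norm_tail_lt (g : I -> K) M : (forall A, \sum_(i <- A) `|g i| <= M) ->
  forall e, 0 < e -> exists A, forall B, [disjoint A & B]%fset ->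
    \sum_(i <- B) `|g i| < e.
Proof.
move=> gM e e0.
have S A : \sum_(i <- A) `|g i| = of_real k (\sum_(i <- A) modulus (g i)).
  by rewrite of_real_sum; apply: eq_bigr => i _; rewrite of_real_modulus.
have M0 : 0 <= M by rewrite (le_trans _ (gM fset0))// sumr_ge0.
have [|||A AP] := @tail_lt (modulus \o g) (modulus M) _ _ (modulus e).
- by move=> i; exact: modulus_ge0.
- by move=> A; rewrite -(le_of_real k) -S modulusK.
- by rewrite -(lt_of_real k) of_real0 modulusK// ltW.
by exists A => B /AP; rewrite -(lt_of_real k) -S modulusK// ltW.
Qed.

Lemma net_sum_ex (g : I -> K) M : (forall A, \sum_(i <- A) `|g i| <= M) ->
  exists s, net_sum g s.
Proof.
move=> gM.
have [e e0|s gs] := @base_field_complete R k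
  (summability.partial_sum g @ summability.totally) _; last by exists s.
have [A AP] := norm_tail_lt gM e0.
exists (summability.partial_sum g A); exists A => // B AB.
rewrite /= /summability.partial_sum -!(big_seq_fsetE _ _ xpredT) /=.
rewrite (sum_fsetD _ AB) opprD addNKr normrN (le_lt_trans (ler_norm_sum _ _ _))//.
by apply: AP; apply/fdisjointP => i iA; rewrite inE iA.
Qed.

End NetSums.

(** * Well-ordered spaces and club sets *)

(* [below o] is the initial segment with last element o, or the empty one when
   o = None; the sets {y <= x | ~~ below o y} with ~~ below o x, i.e. the
   half-open intervals (o, x], form a neighbourhood basis of x. *)
Definition below d (T : porderType d) (o : option T) (x : T) : bool :=
  if o is Some a then (x <= a)%O else false.

Section WellOrdered.
Context d (T : orderTopologicalType d).
Hypothesis wfT : forall A : set T, A !=set0 ->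
  exists2 x, A x & forall y, A y -> (x <= y)%O.

Lemma below_le (o : option T) x y : (x <= y)%O -> below o y -> below o x.
Proof. by case: o => //= a; exact: le_trans. Qed.

Lemma below_max (o o' : option T) : exists o'',
  forall y, below o'' y = below o y || below o' y.
Proof.
case: o o' => [a|] [b|].
- by exists (Some (Order.max a b)) => y /=; rewrite le_max.
- by exists (Some a) => y /=; rewrite orbF.
- by exists (Some b).
- by exists None.
Qed.

(** Either [x] is maximal or it has an immediate successor [s], and then the open ray below [s]
    consists exactly of the points up to [x]. So the right side of [x] never matters. *)
Lemma nbhs_leftP (x : T) (A : set T) : nbhs x A <->
  exists o, ~~ below o x /\ forall y, (y <= x)%O -> ~~ below o y -> A y.
Proof.
split.
  rewrite itv_nbhsE => -[i [iopen xi] isub].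
  case: i iopen xi isub => -[bl l|[]] u iopen xi isub //; last first.
    exists None; split=> // y yx _; apply: isub => /=.
    move: xi; rewrite !itv_boundlr => /andP[_ xu]; apply/andP; split => //.
    by apply: le_trans xu; rewrite bnd_simp.
  exists (Some l) => /=; rewrite -ltNge; split.
    move: xi; rewrite itv_boundlr => /andP[+ _].
    by move/itv_open_ends_lside: iopen => ->; rewrite bnd_simp.
  move=> y yx; rewrite -ltNge => ly; apply: isub => /=.
  move: xi; rewrite !itv_boundlr => /andP[_ xu]; apply/andP; split.
    by move/itv_open_ends_lside: iopen => ->; rewrite bnd_simp.
  by apply: le_trans xu; rewrite bnd_simp.
move=> [ o [ox oA]].
have h1 : nbhs x [set y | (y <= x)%O].
  have [[z xz]|nz] := pselect (exists z, (x < z)%O); last first.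
    apply: filterS filterT => y _ /=; rewrite leNgt; apply/negP => xy.
    by apply: nz; exists y.
  have [|s xs smin] := wfT (A := [set z | (x < z)%O]); first by exists z.
  apply: (@filterS _ _ _ `]-oo, s[%classic); last first.
    by apply: open_nbhs_nbhs; split; [exact: lray_open|rewrite /= in_itv].
  move=> y /=; rewrite in_itv /= => ys; rewrite leNgt; apply/negP => /smin.
  by rewrite leNgt ys.
have h2 : nbhs x [set y | ~~ below o y].
  case: o ox {oA} => [a /= ax|_]; last by apply: filterS filterT.
  apply: (@filterS _ _ _ `]a, +oo[%classic).
    by move=> y /=; rewrite in_itv /= andbT -ltNge.
  by apply: open_nbhs_nbhs; split; [exact: rray_open|rewrite /= in_itv/= andbT ltNge].
by apply: filterS2 h1 h2 => y /=; exact: oA.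
Qed.

Lemma continuous_leftP (K : numFieldType) (f : T -> K) (x : T) :
  {for x, continuous f} <-> forall e, 0 < e -> exists o, ~~ below o x /\
     forall y, (y <= x)%O -> ~~ below o y -> `|f x - f y| < e.
Proof.
split=> [fc e e0|h].
  by apply/nbhs_leftP; have /cvgrPdist_lt/(_ e e0) := fc.
by apply/cvgrPdist_lt => e e0; apply/nbhs_leftP; exact: h.
Qed.

Lemma closed_leftP (D : set T) : closed D <->
  forall x, (forall o, ~~ below o x ->
    exists y, [/\ (y <= x)%O, ~~ below o y & D y]) -> D x.
Proof.
split=> [cD x h|h].
  apply: cD => B /nbhs_leftP[ o [ox oB]].
  by have [y [yx oy Dy]] := h o ox; exists y; split => //; exact: oB.
move=> x cx; apply: h => o ox.
have [|y [Dy [yx oy]]] := cx [set y | (y <= x)%O /\ ~~ below o y].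
  by apply/nbhs_leftP; exists o.
by exists y.
Qed.

Lemma wf_ind (P : T -> Prop) :
  (forall x, (forall y, (y < x)%O -> P y) -> P x) -> forall x, P x.
Proof.
move=> h x; apply: contrapT => nPx.
have [|y nPy ymin] := wfT (A := ~` P); first by exists x.
by apply: nPy; apply: h => z zy; apply: contrapT => /ymin; rewrite leNgt zy.
Qed.

End WellOrdered.

Section Omega1.
Local Notation W := omega1.

(** If [A] had no strict upper bound, [0, omega_1) would be a countable union of countable initial
    segments. *)
Lemma countable_ub (A : set W) : countable A -> exists a, forall x, A x -> (x < a)%O.
Proof.
move=> cA; apply: contrapT => n; apply: uncountable_omega1.
apply: (@sub_countable _ _ _ (\bigcup_(x in A) [set y | (y <= x)%O])).
  apply: subset_card_le => y _; apply: contrapT => ny; apply: n; exists y => x Ax.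
  by rewrite ltNge; apply/negP => yx; apply: ny; exists x.
by apply: bigcup_countable => // x _; exact: omega1_countable_le.
Qed.

Lemma seq_ub (u : nat -> W) : exists a, forall n, (u n < a)%O.
Proof.
have [|a h] := @countable_ub (range u); first exact: (sub_countable (card_image_le u setT)).
by exists a => n; apply: h; exists n.
Qed.

Lemma omega1_gt (x : W) : exists y, (x < y)%O.
Proof. by have [y h] := seq_ub (fun=> x); exists y; exact: (h 0%N). Qed.

Lemma increasing_sup (u : nat -> W) : (forall n, u n < u n.+1)%O ->
  exists s, (forall n, u n < s)%O /\ forall a, (a < s)%O -> exists n, (a < u n)%O.
Proof.
move=> uS; have [a ua] := seq_ub u.
have [|s us smin] := @omega1_min [set s | forall n, (u n < s)%O]; first by exists a.
exists s; split => // b bs; apply: contrapT => n.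
have : (s <= b)%O; last by rewrite leNgt bs.
apply: smin => m; apply: (lt_le_trans (uS m)).
by rewrite leNgt; apply/negP => bu; apply: n; exists m.+1.
Qed.

Lemma seq_mono (u : nat -> W) : (forall n, u n < u n.+1)%O ->
  forall m n, (m <= n)%N -> (u m <= u n)%O.
Proof.
by move=> uS m n mn; apply: (@homo_leq _ u <=%O) => // [y x z|i]; [exact: le_trans|exact: ltW].
Qed.

(** Pigeonhole from uncountable cofinality: if each [A n] were bounded, a common bound of the bounds
    would bound the union. *)
Lemma unbounded_tail (A : nat -> set W) :
  (forall a, exists2 b, (\bigcup_n A n) b & (a <= b)%O) ->
  exists n, forall a, exists2 b, A n b & (a <= b)%O.
Proof.
move=> h; apply: contrapT => H.
have {}H n : exists a, forall b, A n b -> (b < a)%O.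
  apply: contrapT => Hn; apply: H; exists n => a; apply: contrapT => Ha.
  apply: Hn; exists a => b Ab; rewrite ltNge; apply/negP => ab.
  by apply: Ha; exists b.
have [u uA] := choice H; have [a ua] := seq_ub u.
have [b [n _ Ab] ab] := h a; have := lt_trans (uA n b Ab) (ua n).
by rewrite ltNge ab.
Qed.

Lemma unbounded_gt (A : set W) : (forall a, exists2 b, A b & (a <= b)%O) ->
  forall a, exists2 b, A b & (a < b)%O.
Proof.
move=> h a; have [c ac] := omega1_gt a; have [b Ab cb] := h c.
by exists b => //; exact: lt_le_trans cb.
Qed.

Lemma unbounded_increasing (A : set W) : (forall a, exists2 b, A b & (a <= b)%O) ->
  exists u : nat -> W, (forall n, A (u n)) /\ forall n, (u n < u n.+1)%O.
Proof.
move=> /unbounded_gt h; have [a0 _] := omega1_nonempty.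
have /choice[f fP] : forall a, exists b, A b /\ (a < b)%O.
  by move=> a; have [b] := h a; exists b.
exists (fun n => iter n.+1 f a0); split => n /=; first exact: (fP _).1.
exact: (fP _).2.
Qed.

Lemma closed_sup (D : set W) (u : nat -> W) s : closed D -> (forall n, D (u n)) ->
  (forall n, u n < s)%O -> (forall a, (a < s)%O -> exists n, (a < u n)%O) -> D s.
Proof.
move=> /(closed_leftP omega1_min) cD Du us uP; apply: cD => -[a|] /=.
  rewrite -ltNge => /uP[n an]; exists (u n).
  by rewrite -ltNge; split => //; exact: ltW.
by move=> _; exists (u 0%N); split => //; exact: ltW.
Qed.

(** Climbing alternately into [D] and into [E] produces interleaved sequences with one supremum,
    which closedness puts into both sets. *)
Lemma clubI (D E : set W) : club D -> club E -> club (D `&` E).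
Proof.
move=> [cD uD] [cE uE]; split; first exact: closedI.
move=> a.
have /choice[f fP] : forall a, exists b, D b /\ (a < b)%O.
  by move=> b; have [c] := unbounded_gt uD b; exists c.
have /choice[g gP] : forall a, exists b, E b /\ (a < b)%O.
  by move=> b; have [c] := unbounded_gt uE b; exists c.
pose v n := iter n (g \o f) a.
have vS n : (v n < v n.+1)%O.
  by rewrite /v /=; exact: lt_trans (fP _).2 (gP _).2.
have [s [vs sP]] := increasing_sup vS.
exists s; last exact/ltW/(vs 0%N).
split.
  apply: (closed_sup (u := f \o v)) => // [n|n|b /sP[n bn]] /=; first exact: (fP _).1.
    by apply: lt_trans (vs n.+1); exact: (gP _).2.
  by exists n; apply: lt_trans bn _; exact: (fP _).2.
(* The shift by one skips [v 0 = a], which may lie outside [E]. *)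
apply: (closed_sup (u := v \o S)) => // [n|n|b /sP[n bn]] /=.
- exact: (gP _).1.
- exact: (vs n.+1).
by exists n; apply: lt_trans bn _; exact: vS.
Qed.

Lemma clubT : club setT.
Proof. by split; [exact: closedT|move=> a; exists a]. Qed.

Lemma club_ge (D : set W) a : club D -> club (D `&` [set x | (a <= x)%O]).
Proof.
move=> cD; apply: clubI => //; split.
  apply/(closed_leftP omega1_min) => x /(_ None erefl)[y [yx _]] ay.
  exact: le_trans yx.
by move=> b; exists (Order.max a b); rewrite /= le_max lexx ?orbT.
Qed.

Lemma club_closure_points (H : W -> W) : (forall a, a < H a)%O ->
  club [set b | forall a, (a < b)%O -> (H a < b)%O].
Proof.
move=> Hgt; split.
  apply/(closed_leftP omega1_min) => x h a ax.
  have [|y [yx]] := h (Some a); first by rewrite /= -ltNge.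
  by rewrite /= -ltNge => ay /(_ a ay) Hy; exact: lt_le_trans yx.
move=> a.
(* [H] may fail to be monotone, so the iteration uses a strict bound [h b] of [H] on the whole
   countable segment up to [b]. *)
have /choice[h hP] : forall b, exists c, forall x, (x <= b)%O -> (H x < c)%O.
  move=> b; have [|c cP] := @countable_ub (H @` [set x | (x <= b)%O]).
    exact: (sub_countable (card_image_le H _) (omega1_countable_le b)).
  by exists c => x xb; apply: cP; exists x.
pose u n := iter n h a.
have uS n : (u n < u n.+1)%O.
  by apply: lt_trans (Hgt _) _; exact: hP.
have [s [us sP]] := increasing_sup uS.
exists s; last exact/ltW/(us 0%N).
move=> b /sP[n bn]; apply: lt_trans (us n.+1).
by apply: hP; exact: ltW.
Qed.

End Omega1.

Section EventuallyConstant.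
Variables (R : realType) (k : scalars).
Local Notation K := (base_field R k).
Local Notation W := omega1.

(** If no tail stayed within [e] of its first value, an increasing sequence with consecutive values
    at least [e] apart would exist, and [G] would be discontinuous at its supremum. The tails found
    for the tolerances 1/(n+1) then contain a common tail. *)
Lemma eventually_const (G : W -> K) : continuous G ->
  exists b c, forall x, (b <= x)%O -> G x = c.
Proof.
move=> Gc.
have H (e : K) : 0 < e -> exists b, forall x, (b <= x)%O -> `|G x - G b| <= e.
  move=> e0; apply: contrapT => nb0.
  have /choice[f fP] : forall b, exists x, (b < x)%O /\ e <= `|G x - G b|.
    move=> b; apply: contrapT => nb; apply: nb0; exists b => x; rewrite le_eqVlt.
    move=> /orP[/eqP<-|bx]; first by rewrite subrr normr0 ltW.
    rewrite real_leNgt ?normr_real ?gtr0_real//; apply/negP => /ltW h.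
    by apply: nb; exists x.
  have [a0 _] := omega1_nonempty; pose u n := iter n f a0.
  have uS n : (u n < u n.+1)%O by exact: (fP _).1.
  have [s [us sP]] := increasing_sup uS.
  have e2 : 0 < e / 2 by rewrite divr_gt0.
  have /(continuous_leftP omega1_min)/(_ _ e2)[ o [os oP]] := Gc s.
  have [n0 n0P] : exists n, ~~ below o (u n).
    case: o os {oP} => [a|_]; last by exists 0%N.
    by rewrite /= -ltNge => /sP[n0 h]; exists n0; rewrite /= -ltNge.
  have h1 := oP _ (ltW (us n0)) n0P.
  have h2 : `|G s - G (u n0.+1)| < e / 2.
    apply: oP; first exact/ltW.
    by apply: contra n0P; apply: below_le; exact: ltW.
  have := (fP (u n0)).2; rewrite real_leNgt ?normr_real ?gtr0_real// => /negP; apply.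
  rewrite [e]splitr -[f (u n0)]/(u n0.+1) -(subrKA (G s)) (le_lt_trans (ler_normD _ _))//.
  by rewrite ltrD// distrC.
have /choice[u uP] : forall n : nat, exists b, forall x, (b <= x)%O ->
    `|G x - G b| <= (n.+1%:R)^-1.
  by move=> n; apply: H; rewrite invr_gt0 ltr0n.
have [b ub] := seq_ub u.
exists b, (G b) => x bx; apply/eqP; rewrite -subr_eq0; apply/eqP.
(* The index 2n+1 is taken because two errors of 1/(2n+2) add up to 1/(n+1). *)
apply: norm_small0 => n; have n2 : (n < n.*2.+1)%N by rewrite ltnS -addnn leq_addr.
rewrite -(subrKA (G (u n.*2.+1))) (le_trans (ler_normD _ _))//.
have ub' := ltW (ub n.*2.+1).
apply: (@le_trans _ _ ((n.*2.+2)%:R^-1 + (n.*2.+2)%:R^-1)).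
  by rewrite lerD// ?uP ?(le_trans ub')// distrC uP.
by rewrite -doubleS -muln2 natrM invfM -splitr.
Qed.

End EventuallyConstant.

(** * Functionals on C[0, omega_1] *)

Section MkBop.
Variables (K : numFieldType) (X Y : normedModType K) (T : X -> Y).
Hypotheses (Tl : linear T) (Tb : exists M, forall x, `|T x| <= M * `|x|).

Lemma mk_bop_subproof : T \in bop_pred X Y.
Proof. by apply/asboolP. Qed.

Definition mk_bop : 'B(X, Y) := MkBop mk_bop_subproof.

End MkBop.

Lemma bop_bounded_ge0 (K : numFieldType) (X Y : normedModType K) (T : 'B(X, Y)) :
  exists2 M, 0 <= M & forall x, `|T x| <= M * `|x|.
Proof.
have [M TM] := bop_bounded T; exists `|M| => // x.
have Mx : 0 <= M * `|x| by rewrite (le_trans _ (TM x)).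
by rewrite (le_trans (TM x))// -[M * _]ger0_norm// normrM normr_id.
Qed.

Section BopApply.
Variables (K : numFieldType) (X Y : normedModType K).
Implicit Types (S T : 'B(X, Y)).

Lemma bopD_apply S T x : (S + T) x = S x + T x. Proof. by []. Qed.

Lemma bopZ_apply c T x : (c *: T) x = c *: T x. Proof. by []. Qed.

End BopApply.

Lemma eps_le0 (R : realType) (k : scalars) (x M : base_field R k) :
  0 <= M -> (forall e, 0 < e -> `|x| <= M * e) -> x = 0.
Proof.
move=> M0 h; apply/eqP; rewrite -normr_le0; apply: le_eps => // e e0.
rewrite add0r; have M1 : 0 < M + 1 by rewrite ltr_wpDl.
rewrite (le_trans (h (e / (M + 1)) _)) ?divr_gt0// mulrCA ger_pMr//.
by rewrite ler_pdivrMr// mul1r lerDl.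
Qed.

Lemma sum_indicator_le1 (K : numDomainType) (I : choiceType) (A : {fset I})
    (b : I -> bool) :
  (forall i j, i \in A -> j \in A -> b i -> b j -> i = j) ->
  \sum_(i <- A) (b i)%:R <= 1 :> K.
Proof.
move=> h; have [[i [iA bi]]|n] := pselect (exists i, i \in A /\ b i).
  rewrite (big_fsetD1 i)//= bi big_seq big1 ?addr0// => j; rewrite !inE => /andP[ji jA].
  by case bj : (b j) => //; rewrite (h _ _ jA iA bj bi) eqxx in ji.
rewrite big_seq big1// => i iA; case bi : (b i) => //.
by case: n; exists i.
Qed.

Section FiniteBelow.
Context d (T : orderTopologicalType d).

(** Finitely many points cannot accumulate at [x] from the left, so (o, x] can be shrunk until it
    avoids all of them except possibly [x]. *)
Lemma finite_below (s : seq T) (x : T) : exists o, ~~ below o x /\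
  forall y, y \in s -> (y < x)%O -> below o y.
Proof.
elim: s => [|a s [ o [ox oP]]]; first by exists None.
have [ax|xa] := ltP a x; last first.
  exists o; split => // y; rewrite inE => /predU1P[->|]; last exact: oP.
  by rewrite ltNge xa.
have [ o' o'P] := below_max o (Some a).
exists o'; rewrite o'P negb_or ox /= -ltNge ax; split => // y.
by rewrite inE o'P /= => /predU1P[->|/oP h /h ->//]; rewrite lexx orbT.
Qed.

End FiniteBelow.

Section Representation.
Variables (R : realType) (k : scalars).
Local Notation K := (base_field R k).
Local Notation C := (C_omega1c R k).
Local Notation X := omega1c.
Implicit Types (f : C) (mu : 'B(C, K^o)) (o : option X) (x y : X).

Lemma C_le_norm f x : `|f x| <= `|f|.
Proof. exact: le_sup_norm (C_bounded f). Qed.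

Lemma C_norm_le f M : (forall x, `|f x| <= M) -> `|f| <= M.
Proof. by apply: ge_sup_norm; exists omega1_pt. Qed.

Lemma C_ext (f f' : C) : (forall x, f x = f' x) -> f = f'.
Proof. by move=> h; apply: val_inj; apply/funext. Qed.

Lemma C_sum_apply I (r : seq I) (F : I -> C) x :
  (\sum_(i <- r) F i) x = \sum_(i <- r) F i x.
Proof. exact: (linear_sum (eval_at R k x)). Qed.

Lemma mkC_subproof (f : X -> K) : continuous f -> f \in @C_pred R k.
Proof. by move=> fc; apply/asboolP. Qed.

Definition mkC (f : X -> K) (fc : continuous f) : C := MkC (mkC_subproof fc).

Lemma ind_continuous o : continuous (fun x : X => (below o x)%:R : K).
Proof.
move=> x; apply/(continuous_leftP omega1c_min) => e e0.
case ox : (below o x).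
  by exists None; split=> // y yx _; rewrite (below_le yx ox) subrr normr0.
exists o; rewrite ox; split=> // y _ /negbTE->.
by rewrite subrr normr0.
Qed.

Definition ind o : C := mkC (@ind_continuous o).

Lemma cut_continuous o f : continuous (fun x : X => f x * ind o x).
Proof. by move=> x; apply: (@continuousM K omega1c f (ind o) x); exact: (@C_continuous R k). Qed.

Definition cut o f : C := mkC (@cut_continuous o f).

(** The total variation bound in elementary form: rotating every [mu (F i)] to a nonnegative scalar
    merges the [F i] into a single function of norm at most 1. *)
Lemma functional_variation mu M I (r : seq I) (F : I -> C) : 0 <= M ->
  (forall f, `|mu f| <= M * `|f|) ->
  (forall x, \sum_(i <- r) `|F i x| <= 1) -> \sum_(i <- r) `|mu (F i)| <= M.
Proof.
(* Since division by zero gives zero, [s i] is 0 when [mu (F i) = 0]; hence the bound [|s i| <= 1]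
   rather than an equality. *)
move=> M0 muM F1; pose s i : K := `|mu (F i)| / mu (F i).
have s1 i : `|s i| <= 1.
  rewrite normrM normr_id normfV; have [->|n0] := eqVneq (mu (F i)) 0.
    by rewrite normr0 mul0r ler01.
  by rewrite divff// normr_eq0.
have sE i : s i * mu (F i) = `|mu (F i)|.
  rewrite /s; have [->|n0] := eqVneq (mu (F i)) 0; last by rewrite divfK.
  by rewrite mulr0 normr0.
pose f : C := \sum_(i <- r) s i *: F i.
have f1 : `|f| <= 1.
  apply: C_norm_le => x; rewrite C_sum_apply (le_trans _ (F1 x))//.
  rewrite (le_trans (ler_norm_sum _ _ _))//; apply: ler_sum => j _.
  by rewrite -[(s j *: F j) x]/(s j * F j x) normrM ler_piMl.
have -> : \sum_(i <- r) `|mu (F i)| = `|mu f|.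
  rewrite linear_sum [RHS]ger0_norm.
    by apply: eq_bigr => i _; rewrite linearZ -sE.
  by apply: sumr_ge0 => i _; rewrite linearZ -[X in 0 <= X]/(s i * mu (F i)) sE.
by rewrite (le_trans (muM f))// ler_piMr.
Qed.

Definition itv_ind o x : C := ind (Some x) - ind o.

Lemma itv_indE o x y : ~~ below o x ->
  itv_ind o x y = ((y <= x)%O && ~~ below o y)%:R.
Proof.
move=> ox; rewrite -[LHS]/((y <= x)%O%:R - (below o y)%:R : K).
case yx : (y <= x)%O => /=; first by case: below; rewrite ?subrr ?subr0.
case oy : (below o y); last by rewrite subrr.
case: o ox oy => //= a; rewrite -ltNge => ax ya.
by rewrite (le_trans ya (ltW ax)) in yx.
Qed.

(** The scalar [c] is the atom of [mu] at [x]. If the values on (o, x] were not Cauchy as [o] grows,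
    one could pick nested intervals with consecutive values at least [e] apart; their successive
    differences are indicators of disjoint sets, so [functional_variation] bounds the sum of all
    these gaps by [M], which fails after enough steps. *)
Lemma jump_ex mu (x : X) : exists c : K, forall e, 0 < e ->
  exists o, ~~ below o x /\ forall o', ~~ below o' x ->
    (forall y, below o y -> below o' y) -> `|mu (itv_ind o' x) - c| < e.
Proof.
have [M M0 muM] := bop_bounded_ge0 mu.
pose F : set_system K := [set A | exists o, ~~ below o x /\ forall o', ~~ below o' x ->
    (forall y, below o y -> below o' y) -> A (mu (itv_ind o' x))].
have FF : ProperFilter F.
  split; last split.
  - by move=> [ o [ox]] /(_ o ox (fun _ => id)).
  - by exists None.
  - move=> A B [ o1 [ox1 oA]] [ o2 [ox2 oB]].
    have [ o oP] := below_max o1 o2.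
    exists o; split=> [|o' o'x oo']; first by rewrite oP negb_or ox1.
    by split; [apply: oA|apply: oB] => // y yo; apply: oo'; rewrite oP yo ?orbT.
  - move=> A B AB [ o [ox oA]]; exists o; split=> // o' o'x oo'.
    by apply: AB; exact: oA.
have [e e0|c Fc] := @base_field_complete R k F FF; last first.
  exists c => e e0;
  have /fcvgrPdist_lt/(_ e e0)[ o [ox oP]] := Fc.
  by exists o; split=> // o' o'x oo'; rewrite distrC; exact: oP.
apply: contrapT => n.
have /choice[h hP] : forall o, exists o', ~~ below o x ->
    [/\ ~~ below o' x, (forall y, below o y -> below o' y) &
     e <= `|mu (itv_ind o' x) - mu (itv_ind o x)|].
  move=> o; case ox : (below o x); first by exists None.
  apply: contrapT => no; apply: n; exists (mu (itv_ind o x)), o.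
  rewrite ox; split=> // o' o'x oo' /=; rewrite distrC.
  rewrite real_ltNge ?normr_real ?gtr0_real//; apply/negP => he.
  by apply: no; exists o'.
pose u n := iter n h None.
have ux m : ~~ below (u m) x by elim: m => //= m /hP[].
have uM y m : below (u m) y -> below (u m.+1) y.
  by have [_ + _] := hP _ (ux m); exact.
(* This makes [m.+1] gaps of size [e] add up to more than [M + 1]. *)
have [m mP] : exists m : nat, m.+1%:R^-1 < e / (M + 1).
  by apply: archi_inv; rewrite divr_gt0// ltr_wpDl.
have := @functional_variation mu M _ (index_iota 0 m.+1)
  (fun i => itv_ind (u i) x - itv_ind (u i.+1) x) M0 muM.
have telE y j : `|(itv_ind (u j) x - itv_ind (u j.+1) x) y| =
    (below (u j.+1) y)%:R - (below (u j) y)%:R :> K.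
  rewrite -[(itv_ind (u j) x - itv_ind (u j.+1) x) y]/(itv_ind (u j) x y -
    itv_ind (u j.+1) x y).
  rewrite -[itv_ind (u j) x y]/((y <= x)%O%:R - (below (u j) y)%:R : K).
  rewrite -[itv_ind (u j.+1) x y]/((y <= x)%O%:R - (below (u j.+1) y)%:R : K).
  rewrite opprB addrC subrKA.
  by case b : (below (u j) y); [rewrite (uM _ _ b)|case: below];
    rewrite ?subrr ?subr0 ?normr0 ?normr1.
have tel y : \sum_(0 <= j < m.+1) `|(itv_ind (u j) x - itv_ind (u j.+1) x) y| <= 1.
  under eq_bigr => j _ do rewrite telE.
  by rewrite telescope_sumr//= subr0; case: below; rewrite ?ler01.
move=> /(_ tel); rewrite real_leNgt ?ger0_real ?sumr_ge0// => /negP; apply.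
have le1 : \sum_(0 <= j < m.+1) e <=
   \sum_(0 <= j < m.+1) `|mu (itv_ind (u j) x - itv_ind (u j.+1) x)|.
  apply: ler_sum => j _; rewrite linearB distrC.
  by have [] := hP _ (ux j).
apply: lt_le_trans le1; rewrite sumr_const_nat subn0.
move: mP; rewrite invf_plt ?posrE ?ltr0n ?divr_gt0 ?ltr_wpDl// invf_div ltr_pdivrMr//.
rewrite mulr_natl => h1; apply: lt_trans h1; by rewrite ltrDl.
Qed.

(** Each atom is approximated by the value of [mu] on an interval ending at its point. Starting each
    interval beyond all smaller points of [A] makes the intervals disjoint, so
    [functional_variation] applies. *)
Lemma jump_summable mu M (g : X -> K) : 0 <= M -> (forall f, `|mu f| <= M * `|f|) ->
  (forall x e, 0 < e -> exists o, ~~ below o x /\ forall o', ~~ below o' x ->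
    (forall y, below o y -> below o' y) -> `|mu (itv_ind o' x) - g x| < e) ->
  forall A : {fset X}, \sum_(x <- A) `|g x| <= M.
Proof.
move=> M0 muM gP A; apply: le_eps => //; rewrite ?ger0_real ?sumr_ge0// => e e0.
(* The error [e] is shared among the points of [A]; the successor keeps the division meaningful for
   empty [A]. *)
pose N := (size A).+1; have e' : 0 < e / N%:R by rewrite divr_gt0// ltr0n.
have /choice[h hP] : forall x, exists o, [/\ ~~ below o x,
    (forall y, y \in (A : seq X) -> (y < x)%O -> below o y) &
    `|mu (itv_ind o x) - g x| < e / N%:R].
  move=> x; have [ o1 [ox1 o1P]] := gP x _ e'.
  have [ o2 [ox2 o2P]] := finite_below A x.
  have [ o oP] := below_max o1 o2.
  have ox : ~~ below o x by rewrite oP negb_or ox1.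
  exists o; split=> // [y yA yx|]; first by rewrite oP (o2P y yA yx) orbT.
  by apply: o1P => // y yo; rewrite oP yo.
have := @functional_variation mu M _ A (fun x => itv_ind (h x) x) M0 muM.
have var y : \sum_(x <- A) `|itv_ind (h x) x y| <= 1.
  have -> : \sum_(x <- A) `|itv_ind (h x) x y| =
     \sum_(x <- A) ((y <= x)%O && ~~ below (h x) y)%:R.
    by apply: eq_bigr => x _; have [hx _ _] := hP x; rewrite itv_indE// normr_nat.
  apply: sum_indicator_le1 => x x' xA x'A /andP[yx hx] /andP[yx' hx'].
  have key a b : a \in A -> (y <= a)%O -> ~~ below (h b) y -> (b <= a)%O.
    move=> aA ya hb; rewrite leNgt; apply/negP => ab.
    have [_ /(_ a aA ab) hab _] := hP b.
    by rewrite (below_le ya hab) in hb.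
  by apply/le_anti; rewrite (key x x')// (key x' x).
move=> /(_ var) h1.
apply: (@le_trans _ _ (\sum_(x <- A) (`|mu (itv_ind (h x) x)| + e / N%:R))).
  apply: ler_sum => x _; have [_ _ /ltW hx] := hP x.
  rewrite -[g x](subrK (mu (itv_ind (h x) x))) (le_trans (ler_normD _ _))// addrC lerD2l.
  by rewrite distrC.
rewrite big_split /= lerD// big_const_seq count_predT iter_addr_0 -[_ *+ _]mulr_natr.
rewrite -mulrA ger_pMr// ler_pdivrMl ?ltr0n// mulr1 ler_nat; exact: leqnSn.
Qed.

(** Transfinite induction on [x] shows that [mu] kills [f] cut off after [x]; the case of omega_1 is
    the claim. *)
Lemma functional_eq0 mu :
  (forall x e, 0 < e -> exists o, ~~ below o x /\ forall o', ~~ below o' x ->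
    (forall y, below o y -> below o' y) -> `|mu (itv_ind o' x)| <= e) ->
  forall f, mu f = 0.
Proof.
move=> h; have [M M0 muM] := bop_bounded_ge0 mu.
suff H x : forall f, mu (cut (Some x) f) = 0.
  move=> f; rewrite -(H omega1_pt f); congr (mu _); apply: C_ext => -[y|];
  by rewrite /= mulr1.
elim/(wf_ind omega1c_min): x => x IH f.
have {}IH o : ~~ below o x -> mu (cut o f) = 0.
  case: o => [a|_]; first by rewrite /= -ltNge => /IH.
  rewrite -(linear0 mu); congr (mu _); apply: C_ext => y /=.
  by rewrite mulr0.
apply: (@eps_le0 _ _ _ (`|f x| + M)); first by rewrite addr_ge0.
move=> e e0; have [ o1 [ox1 o1P]] := h x e e0.
have /(continuous_leftP omega1c_min)/(_ e e0)[ o2 [ox2 o2P]] := @C_continuous _ _ f x.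
have [ o oP] := below_max o1 o2.
have ox : ~~ below o x by rewrite oP negb_or ox1.
(* On (o, x] this is [f - f x], small by continuity, and elsewhere it is 0. The two subtracted terms
   are controlled by the induction hypothesis and by the absence of an atom at [x]. *)
pose r : C := cut (Some x) f - cut o f - f x *: itv_ind o x.
have re : `|r| <= e.
  apply: C_norm_le => y.
  rewrite -[r y]/(f y * (y <= x)%O%:R - f y * (below o y)%:R - f x * itv_ind o x y).
  rewrite itv_indE//; case yx : (y <= x)%O => /=; case oy : (below o y) => /=;
    rewrite ?(mulr1, mulr0, subrr, subr0, normr0, ltW e0)//.
    rewrite distrC ltW// o2P//; apply: contraFN oy => oy; rewrite oP oy orbT//.
  case: (o) ox oy => //= a; rewrite -ltNge => ax ya.
  by rewrite (le_trans ya (ltW ax)) in yx.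
have -> : mu (cut (Some x) f) = mu (cut o f) + f x *: mu (itv_ind o x) + mu r.
  rewrite -linearZ -linearD -linearD; congr (mu _).
  rewrite /r; move: (cut _ _) (cut _ _) (_ *: _) => a b c.
  by rewrite -(addrA b) -opprD [RHS]addrC subrK.
rewrite IH// add0r mulrDl (le_trans (ler_normD _ _))// lerD//.
  rewrite -[f x *: mu (itv_ind o x)]/(f x * mu (itv_ind o x)) normrM ler_wpM2l// o1P// => y yo.
  by rewrite oP yo.
by rewrite (le_trans (muM r))// ler_wpM2l.
Qed.

(** A purely atomic functional returns its coefficients as atoms: all but mass [e] sits on a finite
    set, and (o, x] can be chosen to avoid that set except possibly at [x]. *)
Lemma net_sum_itv (g : X -> K) M (nu : C -> K) :
  (forall A : {fset X}, \sum_(x <- A) `|g x| <= M) ->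
  (forall f, net_sum (fun x => g x * f x) (nu f)) ->
  forall x e, 0 < e -> exists o, ~~ below o x /\ forall o', ~~ below o' x ->
    (forall y, below o y -> below o' y) -> `|nu (itv_ind o' x) - g x| <= e.
Proof.
move=> gM gnu x e e0; have [A AP] := norm_tail_lt gM e0.
have [ o [ox oA]] := finite_below A x.
exists o; split=> // o' o'x oo'; apply: le_eps => //.
  exact: gtr0_real.
move=> e' e'0; have /net_sumP/(_ e' e'0)[B BP] := gnu (itv_ind o' x).
pose D := (x |` (A `|` B))%fset.
have BD : (B `<=` D)%fset by apply/fsubsetP => i iB; rewrite !inE iB !orbT.
rewrite [e + e']addrC; apply: le_trans (lerD (ltW (BP D BD)) (lexx e)).
set S := \sum_(i <- D) _.
rewrite -[nu _ - g x](subrKA S) (le_trans (ler_normD _ _))// lerD2l.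
have -> : S - g x = \sum_(i <- (D `\ x)%fset) g i * itv_ind o' x i.
  rewrite /S (big_fsetD1 x) ?inE ?eqxx// itv_indE// lexx o'x mulr1.
  by rewrite addrAC subrr add0r.
have AD : ((D `\ x) `&` A `<=` D `\ x)%fset by exact: fsubsetIl.
rewrite (sum_fsetD _ AD) big_seq big1 ?add0r.
  rewrite (le_trans (ler_norm_sum _ _ _))//.
  apply: (@le_trans _ _ (\sum_(i <- ((D `\ x) `\` ((D `\ x) `&` A))%fset) `|g i|)).
    apply: ler_sum => i _; rewrite normrM itv_indE// normr_nat ler_piMr//.
    by case: (_ && _); rewrite ?ler01.
  apply/ltW/AP/fdisjointP => i iA; rewrite !inE iA andbT.
  by case: (i == x); case: (_ || _).
move=> i; rewrite !inE => /andP[/andP[ix _] iA]; rewrite itv_indE//.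
case: (ltgtP i x) ix => //= [ix _|_ _]; last by rewrite mulr0.
by rewrite (oo' _ (oA _ iA ix)) mulr0.
Qed.

Lemma summable_boundP (g : X -> K) : summable setT (fun c => (modulus (g c))%:E) <->
  exists M, forall A : {fset X}, \sum_(x <- A) `|g x| <= M.
Proof.
have S (A : {fset X}) : \sum_(i <- A) `|g i| = of_real k (\sum_(i <- A) modulus (g i)).
  by rewrite of_real_sum; apply: eq_bigr => i _; rewrite of_real_modulus.
rewrite /summable; have -> : (\esum_(c in setT) `|(modulus (g c))%:E| =
    \esum_(c in setT) (modulus (g c))%:E)%E.
  by apply: eq_esum => c _; rewrite gee0_abs// lee_fin modulus_ge0.
split=> [h|[M gM]].
  exists (of_real k (fine (\esum_(c in setT) (modulus (g c))%:E)%E)) => A.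
  rewrite S le_of_real -lee_fin fineK; last first.
    by rewrite ge0_fin_numE// esum_ge0// => i _; rewrite lee_fin modulus_ge0.
  apply: esum_ge; exists [set` A]; first by split.
  by rewrite fsbig_finite// set_fsetK sumEFin.
apply: (@le_lt_trans _ _ (modulus M)%:E); last exact: ltry.
apply: ge_ereal_sup => _ [A [fA _] <-].
rewrite fsbig_finite// sumEFin lee_fin -(le_of_real k) -S.
rewrite of_real_modulus (le_trans (gM _))// real_ler_norm// ger0_real//.
by rewrite (le_trans _ (gM fset0))// sumr_ge0.
Qed.

(** The atoms [g] of [mu] are summable and define a functional [nu] with the same atoms, so
    [mu - nu] vanishes by [functional_eq0]. *)
Lemma represents_ex mu : exists g, represents g mu.
Proof.
have [M M0 muM] := bop_bounded_ge0 mu.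
have /choice[g gP] := jump_ex mu.
have gM := jump_summable M0 muM gP.
have gfM f (A : {fset X}) : \sum_(x <- A) `|g x * f x| <= M * `|f|.
  apply: (@le_trans _ _ (\sum_(x <- A) `|g x| * `|f|)).
    by apply: ler_sum => x _; rewrite normrM ler_wpM2l// C_le_norm.
  by rewrite -mulr_suml ler_wpM2r.
have /choice[nu nuP] : forall f, exists s, net_sum (fun x => g x * f x) s.
  by move=> f; exact: (net_sum_ex (gfM f)).
have nul : linear (nu : C -> K^o).
  move=> a f h; apply: (net_sum_unique (nuP _)).
  have := net_sumD (@net_sumZ _ _ _ a _ _ (nuP f)) (nuP h).
  congr (net_sum _ _); apply/funext => x /=.
  by rewrite mulrCA -mulrDr.
have nub : exists M', forall f, `|nu f : K^o| <= M' * `|f|.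
  exists M => f; apply: (net_sum_norm_le (nuP f)); exists fset0 => B _.
  exact: le_trans (ler_norm_sum _ _ _) (gfM f B).
have := @functional_eq0 (mu - mk_bop nul nub) _.
have H : forall x e, 0 < e -> exists o, ~~ below o x /\ forall o', ~~ below o' x ->
    (forall y, below o y -> below o' y) -> `|(mu - mk_bop nul nub) (itv_ind o' x)| <= e.
  move=> x e e0; have e2 : 0 < e / 2 by rewrite divr_gt0.
  have [ o1 [ox1 o1P]] := gP x _ e2.
  have [ o2 [ox2 o2P]] := net_sum_itv gM nuP x e2.
  have [ o oP] := below_max o1 o2.
  exists o; split=> [|o' o'x oo']; first by rewrite oP negb_or ox1.
  rewrite -[(mu - mk_bop nul nub) _]/(mu (itv_ind o' x) - nu (itv_ind o' x)).
  rewrite -(subrKA (g x)) [e]splitr (le_trans (ler_normD _ _))// lerD//.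
    by apply/ltW/o1P => // y yo; apply: oo'; rewrite oP yo.
  by rewrite distrC o2P// => y yo; apply: oo'; rewrite oP yo orbT.
move=> /(_ H) nu0; exists g; split; first by apply/summable_boundP; exists M.
move=> f; have -> : mu f = nu f by apply/eqP; rewrite -subr_eq0; exact/eqP/nu0.
exact: nuP.
Qed.

End Representation.

(** * The Alspach-Benyamini character *)

Section Vanishing.
Variables (R : realType) (k : scalars).
Local Notation K := (base_field R k).
Local Notation C := (C_omega1c R k).
Local Notation C0 := (C0_omega1 R k).
Local Notation W := omega1.
Implicit Types (f : C0) (h : C).

Lemma C0_le_norm f x : `|f x| <= `|f|.
Proof. exact: (le_sup_norm _ (C0_bounded f)). Qed.

Lemma C0_norm_le f M : (forall x, `|f x| <= M) -> `|f| <= M.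
Proof. exact: (ge_sup_norm omega1_nonempty). Qed.

Lemma C0_ext (f f' : C0) : (forall x, f x = f' x) -> f = f'.
Proof. by move=> E; apply: val_inj; apply/funext. Qed.

Lemma C0D_apply (f f' : C0) x : (f + f') x = f x + f' x. Proof. by []. Qed.

Lemma C0Z_apply (c : K) f x : (c *: f) x = c * f x. Proof. by []. Qed.

Lemma C0_continuous f : continuous f.
Proof. by case: f => f /= /asboolP[]. Qed.

Lemma C0_vanish f : exists a, forall x, (a <= x)%O -> f x = 0.
Proof. by case: f => f /= /asboolP[]. Qed.

Lemma mkC0_subproof (f : W -> K) : continuous f ->
  (exists a, forall x, (a <= x)%O -> f x = 0) -> f \in @C0_pred R k.
Proof. by move=> fc fv; apply/asboolP. Qed.

Definition mkC0 (f : W -> K) (fc : continuous f)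
    (fv : exists a, forall x, (a <= x)%O -> f x = 0) : C0 :=
  MkC0 (mkC0_subproof fc fv).

Lemma C0_sum_apply I (r : seq I) (F : I -> C0) x :
  (\sum_(i <- r) F i) x = \sum_(i <- r) F i x.
Proof. by elim/big_rec2 : _ => // i y1 y2 _ <-. Qed.

Lemma eval0_subproof (b : W) : (fun f : C0 => f b : K^o) \in bop_pred C0 K^o.
Proof.
apply/asboolP; split=> //; exists 1 => f; rewrite mul1r; exact: C0_le_norm.
Qed.

Definition eval0 (b : W) : 'B(C0, K^o) := MkBop (eval0_subproof b).

Lemma ext0_continuous f :
  continuous (fun x : omega1c => if x is Some a then f a else 0 : K).
Proof.
move=> x; apply/(continuous_leftP omega1c_min) => e e0; case: x => [x|].
  have /(continuous_leftP omega1_min)/(_ e e0)[ o [ox oP]] := @C0_continuous f x.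
  exists (omap Some o); split; first by case: (o) ox.
  by case=> // y yx oy; apply: oP => //; case: (o) oy.
have [a fa] := C0_vanish f; exists (Some (Some a)); split => // -[y|] _ /= ay;
  last by rewrite subrr normr0.
rewrite fa ?subrr ?normr0//; apply: ltW; rewrite ltNge; exact: ay.
Qed.

Definition ext0 f : C := mkC (@ext0_continuous f).

Lemma tail_omega1c (o : option omega1c) : ~~ below o None ->
  exists a : W, forall x, (a <= x)%O -> ~~ below o (Some x).
Proof.
case: o => [[a|]|] //= _; last by have [a _] := omega1_nonempty; exists a.
have [b ab] := omega1_gt a; exists b => x bx.
by rewrite -[(_ <= _)%O]/(x <= a)%O -ltNge (lt_le_trans ab).
Qed.

(** Continuity at omega_1 gives a tail for each tolerance 1/(n+1), and countably many tails contain
    a common one. *)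
Lemma C_tail h : exists a : W, forall x, (a <= x)%O -> h (Some x) = h None.
Proof.
have /choice[u uP] : forall n : nat, exists a : W, forall x, (a <= x)%O ->
    `|h (Some x) - h None| <= n.+1%:R^-1.
  move=> n; have e0 : 0 < n.+1%:R^-1 :> K by rewrite invr_gt0 ltr0n.
  have /(continuous_leftP omega1c_min)/(_ _ e0)[ o [ox oP]] := @C_continuous _ _ h None.
  have [a aP] := tail_omega1c ox; exists a => x /aP ax.
  by rewrite distrC ltW// oP.
have [a ua] := seq_ub u; exists a => x ax; apply/eqP.
rewrite -subr_eq0; apply/eqP/norm_small0 => n; apply: uP.
exact: le_trans (ltW (ua n)) ax.
Qed.

Lemma restr_continuous h : continuous (fun x : W => h (Some x) - h None).
Proof.
move=> x; apply/(continuous_leftP omega1_min) => e e0.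
have /(continuous_leftP omega1c_min)/(_ _ e0)[ o [ox oP]] := @C_continuous _ _ h (Some x).
exists (if o is Some (Some a) then Some a else None).
split; first by case: (o) ox => // -[].
move=> y yx oy; by rewrite opprB subrKA oP//; case: (o) ox oy => // -[].
Qed.

Lemma restr_vanish h : exists a : W, forall x, (a <= x)%O -> h (Some x) - h None = 0.
Proof. by have [a ha] := C_tail h; exists a => x /ha ->; rewrite subrr. Qed.

Definition restr h : C0 := mkC0 (@restr_continuous h) (restr_vanish h).

Lemma ext0_linear : linear ext0.
Proof.
by move=> a f g; apply: C_ext => -[x|] //=; rewrite -[RHS]/(a * 0 + 0) mulr0 addr0.
Qed.

Lemma ext0_bound : exists M, forall f, `|ext0 f| <= M * `|f|.
Proof.
exists 1 => f; rewrite mul1r; apply: C_norm_le => -[x|] /=; first exact: C0_le_norm.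
by rewrite normr0.
Qed.

Definition J : 'B(C0, C) := mk_bop ext0_linear ext0_bound.

Lemma restr_linear : linear restr.
Proof.
move=> a f g; apply: C0_ext => x.
rewrite -[LHS]/((a * f (Some x) + g (Some x)) - (a * f None + g None)).
rewrite -[RHS]/(a * (f (Some x) - f None) + (g (Some x) - g None)).
by rewrite mulrBr opprD addrACA.
Qed.

Lemma restr_bound : exists M, forall h, `|restr h| <= M * `|h|.
Proof.
exists 2 => h; apply: C0_norm_le => x /=.
by rewrite mulr_natl mulr2n (le_trans (ler_normB _ _))// lerD// C_le_norm.
Qed.

(** Subtracting the value at omega_1 makes [Q] a left inverse of [J]. Through [Q] and [J],
    functionals and operators on C_0 are studied on C[0, omega_1], where the representation is
    available. *)
Definition Q : 'B(C, C0) := mk_bop restr_linear restr_bound.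

Lemma QJ f : Q (J f) = f.
Proof. by apply: C0_ext => x /=; rewrite subr0. Qed.

Definition ind0 (a : W) : C0 := Q (ind R k (Some (Some a))).

Lemma ind0E a x : ind0 a x = (x <= a)%O%:R.
Proof. by rewrite /= subr0. Qed.

Lemma J_ind0 a : J (ind0 a) = ind R k (Some (Some a)).
Proof. by apply: C_ext => -[x|] //=; rewrite subr0. Qed.

(** At omega_1 the limit defining the atom is attained, as the thresholds for all tolerances 1/(n+1)
    have a common bound. *)
Lemma represents_tail (g : omega1c -> K) (mu : 'B(C, K^o)) : represents g mu ->
  exists a : W, forall b, (a <= b)%O -> mu (itv_ind R k (Some (Some b)) None) = g None.
Proof.
move=> [/summable_boundP[M gM] gmu].
have /choice[u uP] : forall n : nat, exists a : W, forall x, (a <= x)%O ->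
    `|mu (itv_ind R k (Some (Some x)) None) - g None| <= n.+1%:R^-1.
  move=> n; have e0 : 0 < n.+1%:R^-1 :> K by rewrite invr_gt0 ltr0n.
  have [ o [ox oP]] := net_sum_itv gM gmu None e0.
  have [a aP] := tail_omega1c ox; exists a => x ax; apply: oP => // -[y|] oy.
    rewrite -[below _ _]/(y <= x)%O; apply: ltW; apply: lt_le_trans ax.
    by rewrite ltNge; apply/negP => /aP; rewrite oy.
  by rewrite oy in ox.
have [a ua] := seq_ub u; exists a => x ax; apply/eqP.
rewrite -subr_eq0; apply/eqP/norm_small0 => n; apply: uP.
exact: le_trans (ltW (ua n)) ax.
Qed.

(** This stands in for density of the span of the [ind0 a]: pulled back along [Q], the difference
    kills every [ind], hence every interval indicator, and so has no atoms. *)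
Lemma functional0_eq (mu nu : 'B(C0, K^o)) :
  (forall a, mu (ind0 a) = nu (ind0 a)) -> forall f, mu f = nu f.
Proof.
move=> H f; apply/eqP; rewrite -subr_eq0; apply/eqP.
have ind_eq0 o : bcomp (mu - nu) Q (ind R k o) = 0.
  case: o => [[a|]|].
  - by rewrite -[LHS]/(mu (ind0 a) - nu (ind0 a)) H subrr.
  - rewrite /= -[RHS](linear0 (mu - nu)); congr ((mu - nu) _).
    by apply: C0_ext => x /=; rewrite subrr.
  - rewrite /= -[RHS](linear0 (mu - nu)); congr ((mu - nu) _).
    by apply: C0_ext => x /=; rewrite subrr.
have := @functional_eq0 _ _ (bcomp (mu - nu) Q) _ (J f).
rewrite -[bcomp (mu - nu) Q (J f)]/(mu (Q (J f)) - nu (Q (J f))) QJ; apply.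
move=> x e e0; exists None; split=> // o' _ _.
have -> : bcomp (mu - nu) Q (itv_ind R k o' x) =
    bcomp (mu - nu) Q (ind R k (Some x)) - bcomp (mu - nu) Q (ind R k o').
  exact: linearB.
by rewrite !ind_eq0 subrr normr0 ltW.
Qed.

Lemma ab_structure (T : 'B(C0)) : exists c,
  (exists b, forall x, (b <= x)%O -> exists a, forall a', (a <= a')%O ->
     T (ind0 a') x = c) /\
  exists D, club D /\ forall f a, D a -> T f a = c * f a.
Proof.
(* [Q] sends the indicator of (b, omega_1] to [- ind0 b], so the eventual value is minus the atom at
   omega_1 of the pulled back functional. *)
have /choice[g /choice[G gP]] : forall x, exists a c, forall b, (a <= b)%O -> T (ind0 b) x = c.
  move=> x; have [g gmu] := represents_ex (bcomp (eval0 x) (bcomp T Q)).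
  have [a aP] := represents_tail gmu; exists a, (- g None) => b ab.
  rewrite -(aP b ab).
  have QE : Q (itv_ind R k (Some (Some b)) None) = - ind0 b.
    apply: C0_ext => y; rewrite -[RHS]/(- ind0 b y) ind0E.
    rewrite -[LHS]/(1 - (y <= b)%O%:R - (1 - 0) : K).
    by rewrite subr0 addrAC subrr add0r.
  have -> : bcomp (eval0 x) (bcomp T Q) (itv_ind R k (Some (Some b)) None) =
      (T (Q (itv_ind R k (Some (Some b)) None)) : C0) x by [].
  by rewrite QE linearN -[in RHS]/(- - T (ind0 b) x) opprK.
(* The countably many thresholds [g y] with [y <= x] have a bound [a], so on [0, x] the function [G]
   coincides with the continuous [T (ind0 a)]. *)
have Gc : continuous G.
  move=> x.
  have [a aP] : exists a, forall y, (y <= x)%O -> (g y <= a)%O.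
    have [|a aP] := @countable_ub (g @` [set y | (y <= x)%O]).
      exact: (sub_countable (card_image_le g _) (omega1_countable_le x)).
    by exists a => y yx; apply/ltW/aP; exists y.
  apply/(continuous_leftP omega1_min) => e e0.
  have /(continuous_leftP omega1_min)/(_ _ e0)[ o [ox oP]] := @C0_continuous (T (ind0 a)) x.
  exists o; split=> // y yx oy.
  by rewrite -(gP x a) ?aP// -(gP y a) ?aP// oP.
have [b0 [c Gb]] := eventually_const Gc.
exists c; split.
  by exists b0 => x bx; exists (g x) => a' /gP ->; exact: Gb.
have /choice[H0 H0P] : forall a, exists b, forall x, (b <= x)%O -> T (ind0 a) x = 0.
  by move=> a; exact: C0_vanish.
have /choice[H HP] : forall a, exists b, [/\ (a < b)%O, (g a < b)%O & (H0 a < b)%O].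
  move=> a; have [b bP] := omega1_gt (Order.max a (Order.max (g a) (H0 a))).
  by exists b; move: bP; rewrite !gt_max => /andP[-> /andP[-> ->]].
have Hgt a : (a < H a)%O by have [] := HP a.
(* The least ordinal is closed under [H] vacuously. Starting strictly above [b0] excludes it and
   supplies a point below every element of the club. *)
have [b1 b01] := omega1_gt b0.
have cD := club_ge b1 (club_closure_points Hgt).
exists ([set b | forall a, (a < b)%O -> (H a < b)%O] `&` [set x | (b1 <= x)%O]).
split=> // f x [xH /= b1x].
have b0x : (b0 < x)%O := lt_le_trans b01 b1x.
(* If [a < x], closure under [H] places [x] where [T (ind0 a)] already vanishes. If [x <= a], every
   [y < x] has [g y < x <= a], so [T (ind0 a)] and [G] agree on [0, x); both are continuous at [x],
   which is a limit of smaller points. *)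
have key a : T (ind0 a) x = c * (ind0 a) x.
  rewrite ind0E; have [xa|ax] := leP x a; last first.
    rewrite mulr0 H0P//; apply: ltW; apply: lt_trans (xH _ ax).
    by have [] := HP a.
  rewrite mulr1 -(Gb x (ltW b0x)); apply/eqP; rewrite -subr_eq0; apply/eqP.
  apply: (@eps_le0 _ _ _ 2) => // e e0.
  have /(continuous_leftP omega1_min)/(_ _ e0)[ o1 [ox1 o1P]] := @C0_continuous (T (ind0 a)) x.
  have /(continuous_leftP omega1_min)/(_ _ e0)[ o2 [ox2 o2P]] := Gc x.
  have [y [yx oy1 oy2]] : exists y, [/\ (y < x)%O, ~~ below o1 y & ~~ below o2 y].
    have [ o oP] := below_max o1 o2.
    have ox : ~~ below o x by rewrite oP negb_or ox1.
    suff [y yx] : exists2 y, (y < x)%O & ~~ below o y.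
      by rewrite oP negb_or => /andP[]; exists y.
    case: o ox {oP} => [z|_]; last by exists b0.
    by rewrite /= -ltNge => /xH zx; exists (H z) => //=; rewrite -ltNge.
  have -> : T (ind0 a) x - G x = (T (ind0 a) x - T (ind0 a) y) + (G y - G x).
    rewrite (gP y a) ?subrKA//; apply: le_trans xa; apply: ltW.
    by apply: lt_trans (xH _ yx); have [] := HP y.
  rewrite (le_trans (ler_normD _ _))// mulr_natl mulr2n lerD// ltW//.
    by rewrite o1P// ltW.
  by rewrite distrC o2P// ltW.
exact: (@functional0_eq (bcomp (eval0 x) T) (c *: eval0 x) key f).
Qed.

(** Two clubs share a point [b], and testing on [ind0 b], which is 1 at [b], identifies the two
    scalars. *)
Lemma ab_character_eq (T : 'B(C0)) (D : set W) c : club D ->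
  (forall f a, D a -> T f a = c * f a) -> ab_character T = c.
Proof.
move=> cD TD; rewrite /ab_character.
case: xgetP => [c' _ [D' [cD' TD']]|]; last by move/(_ c); case; exists D.
have [_ /(_ (sval (cid omega1_nonempty)))[b [Db D'b] _]] := clubI cD cD'.
have := TD (ind0 b) b Db; rewrite (TD' (ind0 b) b D'b) ind0E lexx !mulr1.
by [].
Qed.

Lemma ab_characterP (T : 'B(C0)) : exists D, club D /\
  forall f a, D a -> T f a = ab_character T * f a.
Proof.
have [c [_ [D [cD TD]]]] := ab_structure T.
by exists D; rewrite (ab_character_eq cD TD).
Qed.

Lemma id_linear : linear (@id C0). Proof. by []. Qed.

Lemma id_bound : exists M, forall f, `|id f| <= M * `|f|.
Proof. by exists 1 => f; rewrite mul1r. Qed.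

Definition bid : 'B(C0) := mk_bop id_linear id_bound.

Lemma ab_character_id : ab_character bid = 1.
Proof. by apply: (ab_character_eq clubT) => f a _; rewrite mul1r. Qed.

Lemma ab_character0 : ab_character (0 : 'B(C0)) = 0.
Proof. by apply: (ab_character_eq clubT) => f a _; rewrite mul0r. Qed.

Lemma ab_characterD (S T : 'B(C0)) :
  ab_character (S + T) = ab_character S + ab_character T.
Proof.
have [D [cD SD]] := ab_characterP S; have [E [cE TE]] := ab_characterP T.
apply: (ab_character_eq (clubI cD cE)) => f a [/SD Sa /TE Ta].
by rewrite bopD_apply C0D_apply Sa Ta mulrDl.
Qed.

Lemma ab_characterZ c (T : 'B(C0)) : ab_character (c *: T) = c * ab_character T.
Proof.
have [D [cD TD]] := ab_characterP T.
by apply: (ab_character_eq cD) => f a /TD Ta; rewrite bopZ_apply C0Z_apply Ta mulrA.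
Qed.

Lemma ab_characterM (S T : 'B(C0)) :
  ab_character (bcomp S T) = ab_character S * ab_character T.
Proof.
have [D [cD SD]] := ab_characterP S; have [E [cE TE]] := ab_characterP T.
apply: (ab_character_eq (clubI cD cE)) => f a [/SD Sa /TE Ta].
by rewrite /= Sa Ta mulrA.
Qed.

(** Any representation that [xget] may select has the same coefficient at omega_1, namely the
    eventual value on the tails (a', omega_1]. *)
Lemma op_matrix_tail (S : 'B(C)) b : exists a : W, forall a', (a <= a')%O ->
  S (itv_ind R k (Some (Some a')) None) b = op_matrix S b omega1_pt.
Proof.
apply: (@represents_tail _ (adjoint S (eval_at R k b))); rewrite /op_matrix.
exact: (xgetPex _ (represents_ex (adjoint S (eval_at R k b)))).
Qed.

(** With [c] the character of [Q S J], the last matrix column equals its value at omega_1 minus [c]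
    on a tail: the two entries are values of [S 1 - S 1_[0,a]], and [S 1] is eventually constant.
    Continuity at omega_1 therefore says exactly [c = 0]. *)
Lemma loy_willis_CE (S : 'B(C)) :
  loy_willis_C S <-> ab_character (bcomp Q (bcomp S J)) = 0.
Proof.
set T := bcomp _ _; have [c [[b bP] [D [cD TD]]]] := ab_structure T.
rewrite (ab_character_eq cD TD); set h := fun b => op_matrix S b omega1_pt.
have [b1 b1P] := C_tail (S (ind R k (Some None))).
have [b2 hc] : exists b2 : W, forall x, (b2 <= x)%O -> h (Some x) = h None - c.
  exists (Order.max b b1) => x; rewrite ge_max => /andP[bx b1x].
  have [a1 a1P] := bP x bx; have [a2 a2P] := op_matrix_tail S (Some x).
  have [a3 a3P] := op_matrix_tail S None.
  pose a := Order.max a1 (Order.max a2 a3).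
  have la1 : (a1 <= a)%O by rewrite le_max lexx.
  have la2 : (a2 <= a)%O by rewrite !le_max lexx orbT.
  have la3 : (a3 <= a)%O by rewrite !le_max lexx !orbT.
  rewrite -(a1P a la1) /h -(a2P a la2) -(a3P a la3).
  have -> : T (ind0 a) x =
      S (ind R k (Some (Some a))) (Some x) - S (ind R k (Some (Some a))) None.
    by rewrite -J_ind0.
  rewrite linearB.
  rewrite -[LHS]/(S (ind R k (Some None)) (Some x) - S (ind R k (Some (Some a))) (Some x)).
  rewrite -[X in X - (_ - _)]/(S (ind R k (Some None)) None -
    S (ind R k (Some (Some a))) None).
  by rewrite b1P// opprB subrKA.
split=> [/(continuous_leftP omega1c_min) hcont|c0].
  apply/eqP/negPn/negP => c0; have e0 : 0 < `|c| by rewrite normr_gt0.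
  have [ o [oN oP]] := hcont _ e0; have [a aP] := tail_omega1c oN.
  have := oP (Some (Order.max a b2)) erefl.
  rewrite -[op_matrix S (Some _) _]/(h (Some (Order.max a b2))) hc ?le_max ?lexx ?orbT//.
  rewrite opprB addrC subrK ltxx => H.
  by suff : false by []; apply: H; apply: aP; rewrite le_max lexx.
apply/(continuous_leftP omega1c_min) => e e0; exists (Some (Some b2)); split=> //.
case=> [x|] _ bx; last by rewrite subrr normr0.
rewrite -[op_matrix S (Some x) _]/(h (Some x)) hc ?c0 ?subr0 ?subrr ?normr0//.
by apply: ltW; rewrite ltNge.
Qed.

End Vanishing.

(** * The Loy-Willis ideal and factorization of the identity *)

Section Shift.
Local Notation W := omega1.

Lemma zero_ex : exists z : W, forall x, (z <= x)%O.
Proof.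
have [z _ zP] := omega1_min omega1_nonempty.
by exists z => x; exact: zP.
Qed.

Definition zero : W := sval (cid zero_ex).

Lemma zero_le x : (zero <= x)%O. Proof. exact: (svalP (cid zero_ex)). Qed.

Lemma succ_ex (x : W) : exists y, (x < y)%O /\ forall z, (x < z)%O -> (y <= z)%O.
Proof.
have [y0 xy0] := omega1_gt x.
have [|y xy yP] := @omega1_min [set y | (x < y)%O]; first by exists y0.
by exists y.
Qed.

Definition succ (x : W) : W := sval (cid (succ_ex x)).

Lemma lt_succ x : (x < succ x)%O. Proof. exact: (svalP (cid (succ_ex x))).1. Qed.

Lemma succ_le x y : (x < y)%O -> (succ x <= y)%O.
Proof. exact: (svalP (cid (succ_ex x))).2. Qed.

Lemma lt_succ_succ x y : (x < y)%O -> (succ x < succ y)%O.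
Proof. by move=> /succ_le h; exact: le_lt_trans (lt_succ y). Qed.

Lemma succ_inj : injective succ.
Proof.
by move=> x y e; case: (ltgtP x y) => // /lt_succ_succ; rewrite e ltxx.
Qed.

Definition limit_point (x : W) := (zero < x)%O /\ forall y, (y < x)%O -> (succ y < x)%O.

(** Splits the continuity proofs: a one-point left neighbourhood leaves nothing to check, while at a
    limit point [shift] and [unshift] act as the identity. *)
Lemma limit_or_isolated (x : W) : limit_point x \/
  exists o, ~~ below o x /\ forall y, (y <= x)%O -> ~~ below o y -> y = x.
Proof.
have [[y <-]|ns] := pselect (exists y, succ y = x).
  right; exists (Some y); rewrite /= -ltNge lt_succ; split => // z zy.
  by rewrite -ltNge => /succ_le yz; apply/le_anti; rewrite zy yz.
have [x0|x0] := eqVneq x zero.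
  right; exists None; split=> // y yx _; apply/le_anti.
  by rewrite yx x0 zero_le.
left; split; first by rewrite lt_neqAle eq_sym x0 zero_le.
move=> y /succ_le; rewrite le_eqVlt => /orP[/eqP e|//].
by case: ns; exists y.
Qed.

Lemma omega_ex : exists w, limit_point w /\ forall x, limit_point x -> (w <= x)%O.
Proof.
pose u n := iter n succ zero.
have [s [us sP]] := increasing_sup (fun n => lt_succ (u n)).
have [|w wl wP] := @omega1_min limit_point; last by exists w.
exists s; split; first exact: (us 0%N).
move=> y /sP[n yn]; apply: le_lt_trans (us n.+1).
exact: le_trans (succ_le yn) (ltW (lt_succ _)).
Qed.

Definition omega : W := sval (cid omega_ex).

Lemma omega_limit : limit_point omega. Proof. exact: (svalP (cid omega_ex)).1. Qed.

Lemma omega_le x : limit_point x -> (omega <= x)%O.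
Proof. exact: (svalP (cid omega_ex)).2. Qed.

Lemma pred_ex x : (x < omega)%O -> x != zero -> exists y, succ y = x.
Proof.
move=> xw x0; apply: contrapT => n.
have /omega_le : limit_point x; last by rewrite leNgt xw.
split; first by rewrite lt_neqAle eq_sym x0 zero_le.
by move=> y /succ_le; rewrite le_eqVlt => /orP[/eqP e|//]; case: n; exists y.
Qed.

(* An order isomorphism of [0, omega_1) onto the nonzero ordinals. *)
Definition shift (x : W) : W := if (x < omega)%O then succ x else x.

(** At [zero], which is outside the range of [shift], the value [zero] is a placeholder. *)
Definition unshift (x : W) : W :=
  if (x < omega)%O then
    if pselect (exists y, succ y = x) is left e then sval (cid e) else zero
  else x.

Lemma shiftK : cancel shift unshift.
Proof.
move=> x; rewrite /shift; have [xw|wx] := ltP x omega; last by rewrite /unshift ltNge wx.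
rewrite /unshift omega_limit.2//; case: pselect => [e|[]]; last by exists x.
by apply: succ_inj; exact: (svalP (cid e)).
Qed.

Lemma succ_unshift x : (x < omega)%O -> x != zero -> succ (unshift x) = x.
Proof.
move=> xw x0; rewrite /unshift xw; case: pselect => [e|[]]; last exact: pred_ex.
exact: (svalP (cid e)).
Qed.

Lemma unshiftK x : x != zero -> shift (unshift x) = x.
Proof.
move=> x0; have [xw|wx] := ltP x omega.
  have e := succ_unshift xw x0; rewrite /shift e ifT//.
  by rewrite (lt_trans _ xw)// -[ltRHS]e lt_succ.
have e : unshift x = x by rewrite /unshift ltNge wx.
by rewrite e /shift ltNge wx.
Qed.

Lemma shift_neq0 x : shift x != zero.
Proof.
rewrite /shift; case: ifPn => [_|].
  by rewrite gt_eqF// (le_lt_trans (zero_le x) (lt_succ x)).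
by rewrite -leNgt => wx; rewrite gt_eqF// (lt_le_trans omega_limit.1).
Qed.

Lemma le_shift x : (x <= shift x)%O.
Proof. by rewrite /shift; case: ifP => // _; exact/ltW/lt_succ. Qed.

Lemma shift_le x : (shift x <= succ x)%O.
Proof. by rewrite /shift; case: ifP => // _; exact/ltW/lt_succ. Qed.

Lemma shift_limit x : limit_point x -> shift x = x.
Proof. by move=> /omega_le wx; rewrite /shift ltNge wx. Qed.

Lemma unshift_limit x : limit_point x -> unshift x = x.
Proof. by move=> /omega_le wx; rewrite /unshift ltNge wx. Qed.

Lemma unshift_le x : x != zero -> (unshift x <= x)%O.
Proof.
move=> x0; have [xw|wx] := ltP x omega; last by rewrite /unshift ltNge wx.
by rewrite -[leRHS](succ_unshift xw x0) ltW// lt_succ.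
Qed.

Lemma lt_unshift a x : (succ a < x)%O -> (a < unshift x)%O.
Proof.
move=> ax; have x0 : x != zero by rewrite gt_eqF// (le_lt_trans (zero_le (succ a)) ax).
have [xw|wx] := ltP x omega; last first.
  by rewrite /unshift [(x < omega)%O]ltNge wx (lt_trans (lt_succ a)).
rewrite ltNge; apply/negP => h; move: ax; rewrite ltNge => /negP; apply.
rewrite -[leLHS](succ_unshift xw x0); move: h; rewrite le_eqVlt => /orP[/eqP->//|].
by move=> /lt_succ_succ/ltW.
Qed.

End Shift.

Section HyperplaneIso.
Variables (R : realType) (k : scalars).
Local Notation K := (base_field R k).
Local Notation C := (C_omega1c R k).
Local Notation C0 := (C0_omega1 R k).
Local Notation W := omega1.

(** C[0, omega_1] exceeds C_0 by one dimension, the value at omega_1. It is stored at the isolated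
    point [zero], which [shift] has vacated. *)
Definition U_fun (f : C) (x : W) : K :=
  if x == zero then f None else f (Some (unshift x)) - f None.

Lemma U_continuous f : continuous (U_fun f).
Proof.
move=> x; apply/(continuous_leftP omega1_min) => e e0.
have [xl|[ o [ox oP]]] := limit_or_isolated x; last first.
  by exists o; split=> // y yx oy; rewrite (oP y yx oy) subrr normr0.
have /(continuous_leftP omega1c_min)/(_ _ e0)[ o [ox oP]] := @C_continuous _ _ f (Some x).
have x0 : x != zero by rewrite gt_eqF// xl.1.
have main o' : ~~ below o' x ->
    (forall y, ~~ below o' y -> y != zero /\ ~~ below o (Some (unshift y))) ->
    exists o, ~~ below o x /\ forall y, (y <= x)%O -> ~~ below o y ->
     `|U_fun f x - U_fun f y| < e.
  move=> o'x o'P; exists o'; split=> // y yx /o'P[y0 oy].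
  rewrite /U_fun (negbTE x0) (negbTE y0) opprB subrKA (unshift_limit xl) oP//.
  rewrite -[(_ <= _)%O]/(unshift y <= x)%O; exact: le_trans (unshift_le y0) yx.
case: o ox oP main => [[a|]|] ox oP main //.
  have {}ox : (a < x)%O by rewrite ltNge; exact: ox.
  (* [unshift] moves a point down by at most one step, hence the threshold [succ a] in place of
     [a]. *)
  apply: (main (Some (succ a))) => [|y]; rewrite /= -ltNge; first exact: xl.2.
  move=> ay; split; first by rewrite gt_eqF// (le_lt_trans (zero_le (succ a)) ay).
  rewrite -[(_ <= _)%O]/(unshift y <= a)%O -ltNge; exact: lt_unshift.
apply: (main (Some zero)) => [|y]; rewrite /= -ltNge; first exact: xl.1.
by move=> ay; rewrite gt_eqF.
Qed.

Lemma U_vanish f : exists a, forall x, (a <= x)%O -> U_fun f x = 0.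
Proof.
have [a fa] := C_tail f; have [b ab] := omega1_gt (succ a); exists b => x bx.
have ax := lt_le_trans ab bx.
rewrite /U_fun gt_eqF ?fa ?subrr//; last exact: le_lt_trans (zero_le (succ a)) ax.
by apply: ltW; exact: lt_unshift.
Qed.

Definition U_op f : C0 := mkC0 (@U_continuous f) (U_vanish f).

Lemma U_linear : linear U_op.
Proof.
move=> a f g; apply: C0_ext => x.
rewrite -[LHS]/(U_fun (a *: f + g) x) -[RHS]/(a * U_fun f x + U_fun g x) /U_fun.
case: ifP => // _; set y := unshift x.
rewrite -[LHS]/((a * f (Some y) + g (Some y)) - (a * f None + g None)).
by rewrite mulrBr opprD addrACA.
Qed.

Lemma U_bound : exists M, forall f, `|U_op f| <= M * `|f|.
Proof.
exists 2 => f; apply: C0_norm_le => x; rewrite -[U_op f x]/(U_fun f x) /U_fun.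
rewrite mulr_natl mulr2n; case: ifP => _; first by rewrite ler_wpDl// C_le_norm.
by rewrite (le_trans (ler_normB _ _))// lerD// C_le_norm.
Qed.

Definition U_iso : 'B(C, C0) := mk_bop U_linear U_bound.

Definition V_fun (g : C0) (x : omega1c) : K :=
  if x is Some x then g (shift x) + g zero else g zero.

Lemma V_continuous g : continuous (V_fun g).
Proof.
move=> x; apply/(continuous_leftP omega1c_min) => e e0; case: x => [x|]; last first.
  have [a ga] := C0_vanish g; exists (Some (Some a)); split=> // -[y|] _ ay /=;
    last by rewrite subrr normr0.
  rewrite (ga (shift y)) ?add0r ?subrr ?normr0//; apply: le_trans (le_shift y).
  by apply: ltW; rewrite ltNge; exact: ay.
have H o' : ~~ below o' x -> (forall y, (y <= x)%O -> ~~ below o' y ->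
      `|g (shift x) - g (shift y)| < e) ->
    exists o : option omega1c, ~~ below o (Some x) /\
     forall y : omega1c, (y <= (Some x : omega1c))%O -> ~~ below o y ->
     `|V_fun g (Some x) - V_fun g y| < e.
  move=> ox oP; exists (omap Some o'); split; first by case: (o') ox.
  move=> [y|//] yx oy /=; rewrite opprD addrACA subrr addr0.
  by apply: oP => //; case: (o') oy.
have [xl|[ o [ox oP]]] := limit_or_isolated x; last first.
  by apply: (H o) => // y yx oy; rewrite (oP y yx oy) subrr normr0.
have /(continuous_leftP omega1_min)/(_ _ e0)[ o [ox oP]] := @C0_continuous _ _ g x.
apply: (H o) => // y yx oy; rewrite (shift_limit xl) oP//.
  move: yx; rewrite le_eqVlt => /orP[/eqP->|/xl.2 yx]; first by rewrite shift_limit.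
  exact: le_trans (shift_le y) (ltW yx).
by apply: contra oy; apply: below_le; exact: le_shift.
Qed.

Definition V_op g : C := mkC (@V_continuous g).

Lemma V_linear : linear V_op.
Proof.
move=> a f g; apply: C_ext => -[x|] //.
rewrite -[LHS]/((a * f (shift x) + g (shift x)) + (a * f zero + g zero)).
rewrite -[RHS]/(a * (f (shift x) + f zero) + (g (shift x) + g zero)).
by rewrite mulrDr addrACA.
Qed.

Lemma V_bound : exists M, forall g, `|V_op g| <= M * `|g|.
Proof.
exists 2 => g; apply: C_norm_le => x; rewrite -[V_op g x]/(V_fun g x).
rewrite mulr_natl mulr2n; case: x => [x|] /=; last by rewrite ler_wpDl// C0_le_norm.
by rewrite (le_trans (ler_normD _ _))// lerD// C0_le_norm.
Qed.

Definition V_iso : 'B(C0, C) := mk_bop V_linear V_bound.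

Lemma U_isoK : cancel U_iso V_iso.
Proof.
move=> f; apply: C_ext => -[x|]; last first.
  by rewrite -[LHS]/(U_fun f zero) /U_fun eqxx.
rewrite -[LHS]/(U_fun f (shift x) + U_fun f zero) /U_fun eqxx.
by rewrite (negbTE (shift_neq0 x)) shiftK subrK.
Qed.

Lemma V_isoK : cancel V_iso U_iso.
Proof.
move=> g; apply: C0_ext => x; rewrite -[LHS]/(U_fun (V_iso g) x) /U_fun.
have [->//|x0] := eqVneq x zero.
rewrite -[LHS]/((g (shift (unshift x)) + g zero) - g zero).
by rewrite unshiftK// addrK.
Qed.

Lemma bop_ext (Y Z : normedModType K) (S T : 'B(Y, Z)) : (forall f, S f = T f) -> S = T.
Proof. by move=> h; apply: val_inj; apply/funext. Qed.

(** Independence of the isomorphism comes from multiplicativity: in [(Q V) T (U J)] the scalar of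
    [T] commutes out, and what remains is the character of [Q V U J = Q J], the identity. *)
Lemma loy_willisE : loy_willis R k = [set T | ab_character T = 0].
Proof.
have key (T : 'B(C0)) (U : 'B(C, C0)) (V : 'B(C0, C)) : cancel U V -> cancel V U ->
    ab_character (bcomp (Q R k) (bcomp (bcomp V (bcomp T U)) (J R k))) = ab_character T.
  move=> UK VK.
  have -> : bcomp (Q R k) (bcomp (bcomp V (bcomp T U)) (J R k)) =
      bcomp (bcomp (Q R k) V) (bcomp T (bcomp U (J R k))) by exact: bop_ext.
  rewrite !ab_characterM mulrCA -ab_characterM.
  have -> : bcomp (bcomp (Q R k) V) (bcomp U (J R k)) = bid R k.
    apply: bop_ext => f; rewrite -[LHS]/(Q R k (V (U (J R k f)))) UK.
    exact: QJ.
  by rewrite ab_character_id mulr1.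
apply/seteqP; split=> T /= => [[U [V [UK VK /loy_willis_CE]]]|T0].
  by rewrite key.
exists U_iso, V_iso; split; [exact: U_isoK|exact: V_isoK|].
by apply/loy_willis_CE; rewrite key; [|exact: U_isoK|exact: V_isoK].
Qed.

End HyperplaneIso.

(** * Increasing enumeration of a club and the operators it induces *)

Section Factorization.
Variables (R : realType) (k : scalars).
Local Notation K := (base_field R k).
Local Notation C0 := (C0_omega1 R k).
Local Notation W := omega1.
Variable D : set W.
Hypothesis cD : club D.

Lemma enum_step (x : W) (e : forall y, (y < x)%O -> W) :
  exists d, [/\ D d, forall y (yx : (y < x)%O), (e y yx < d)%O &
    forall d', D d' -> (forall y (yx : (y < x)%O), (e y yx < d')%O) -> (d <= d')%O].
Proof.
pose A := [set d | D d /\ forall y (yx : (y < x)%O), (e y yx < d)%O].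
have [|d [Dd ed] dmin] := @omega1_min A; last by exists d; split=> // d' Dd' h; apply: dmin.
(* A total extension of [e], so that the bound for countable images applies; the value [x] off the
   domain can only raise that bound. *)
pose e' y := if pselect (y < x)%O is left yx then e y yx else x.
have [|a aP] := @countable_ub (e' @` [set y | (y <= x)%O]).
  exact: (sub_countable (card_image_le e' _) (omega1_countable_le x)).
have [d Dd ad] := cD.2 a; exists d; split=> // y yx; apply: lt_le_trans ad.
apply: aP; exists y; first exact: ltW.
rewrite /e'; case: pselect => // yx'; congr (e y _); exact: bool_irrelevance.
Qed.

Lemma omega1_wf : well_founded (fun x y : W => (x < y)%O).
Proof. by apply: (wf_ind omega1_min) => x IH; constructor. Qed.

Definition club_enum : W -> W :=
  Fix omega1_wf (fun=> W) (fun x e => sval (cid (enum_step e))).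

Lemma club_enumP x : [/\ D (club_enum x),
    forall y, (y < x)%O -> (club_enum y < club_enum x)%O &
    forall d, D d -> (forall y, (y < x)%O -> (club_enum y < d)%O) -> (club_enum x <= d)%O].
Proof.
have -> : club_enum x = sval (cid (@enum_step x (fun y _ => club_enum y))).
  rewrite [LHS]Fix_eq// => {}x f g fg.
  by have -> : f = g by apply/functional_extensionality_dep => y; apply/funext.
by case: cid => d /= [Dd h1 h2]; split.
Qed.

Lemma club_enum_lt x y : (x < y)%O -> (club_enum x < club_enum y)%O.
Proof. by have [_ + _] := club_enumP y; exact. Qed.

Lemma club_enum_le x y : (x <= y)%O -> (club_enum x <= club_enum y)%O.
Proof. by rewrite le_eqVlt => /orP[/eqP->//|/club_enum_lt/ltW]. Qed.

Lemma le_club_enum x : (x <= club_enum x)%O.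
Proof.
elim/(wf_ind omega1_min): x => x IH; rewrite leNgt; apply/negP => ex.
by have := IH _ ex; rewrite leNgt club_enum_lt.
Qed.

(** Continuity of the enumeration, where closedness of [D] enters. At a limit [x] the least upper
    bound [b] of the earlier values lies in [D] and strictly exceeds them, so [club_enum x <= b],
    and no [a] below [club_enum x] bounds them all. *)
Lemma club_enum_left x o : ~~ below o (club_enum x) ->
  exists o', ~~ below o' x /\
    forall y, (y <= x)%O -> ~~ below o' y -> ~~ below o (club_enum y).
Proof.
move=> ox; have [_ _ xmin] := club_enumP x.
case: o ox => [a|_]; last by exists None.
rewrite /= -ltNge => ax.
have [[y yx ay]|n] := pselect (exists2 y, (y < x)%O & (a < club_enum y)%O).
  exists (Some y); rewrite /= -ltNge; split=> // z _; rewrite -!ltNge => yz.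
  exact: lt_trans ay (club_enum_lt yz).
suff : exists o', ~~ below o' x /\ forall y, (y <= x)%O -> ~~ below o' y -> y = x.
  move=> [ o' [ o'x o'P]]; exists o'; split=> // y yx oy.
  by rewrite (o'P _ yx oy) -ltNge.
have [xl|//] := limit_or_isolated x.
have na y : (y < x)%O -> (club_enum y <= a)%O.
  by move=> yx; rewrite leNgt; apply/negP => ay; apply: n; exists y.
have [|b bP bmin] := @omega1_min [set b | forall y, (y < x)%O -> (club_enum y <= b)%O].
  by exists a.
have Db : D b.
  have /(closed_leftP omega1_min) := cD.1; apply => -[c|_].
    rewrite /= -ltNge => cb; apply: contrapT => nc.
    have /bmin : [set b | forall y, (y < x)%O -> (club_enum y <= b)%O] c.
      move=> y yx; rewrite leNgt; apply/negP => cy; apply: nc.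
      exists (club_enum y); rewrite -ltNge; split=> //; first exact: bP.
      by have [] := club_enumP y.
    by rewrite leNgt cb.
  exists (club_enum zero); split=> //; first exact/bP/xl.1.
  by have [] := club_enumP zero.
have /(xmin _ Db) : forall y, (y < x)%O -> (club_enum y < b)%O.
  move=> y /xl.2 yx; apply: lt_le_trans (bP _ yx); exact/club_enum_lt/lt_succ.
by move=> xb; have := lt_le_trans ax (le_trans xb (bmin _ na)); rewrite ltxx.
Qed.

Lemma club_rank_ex x : exists y, (x <= club_enum y)%O /\
  forall z, (x <= club_enum z)%O -> (y <= z)%O.
Proof.
have [|y xy yP] := @omega1_min [set y | (x <= club_enum y)%O]; last by exists y.
by exists x; exact: le_club_enum.
Qed.

Definition club_rank x : W := sval (cid (club_rank_ex x)).

(** [club_rank] is the left adjoint of [club_enum]; monotonicity, [club_enumK] and the continuity of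
    [expand] are read off from this equivalence. *)
Lemma club_rank_leP x y : (club_rank x <= y)%O = (x <= club_enum y)%O.
Proof.
have [h1 h2] := svalP (cid (club_rank_ex x)).
apply/idP/idP => [xy|]; last exact: h2.
exact: le_trans h1 (club_enum_le xy).
Qed.

Lemma club_enumK : cancel club_enum club_rank.
Proof.
move=> x; apply/le_anti; rewrite club_rank_leP lexx/= leNgt; apply/negP => h.
have := club_enum_lt h; rewrite ltNge => /negP; apply.
by rewrite -club_rank_leP.
Qed.

Lemma club_rank_mono x y : (x <= y)%O -> (club_rank x <= club_rank y)%O.
Proof. by move=> xy; rewrite club_rank_leP (le_trans xy)// -club_rank_leP. Qed.

Lemma compress_continuous (f : C0) : continuous (f \o club_enum).
Proof.
move=> x; apply/(continuous_leftP omega1_min) => e e0.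
have /(continuous_leftP omega1_min)/(_ _ e0)[ o [ox oP]] := @C0_continuous _ _ f (club_enum x).
have [ o' [ o'x o'P]] := club_enum_left ox.
by exists o'; split=> // y yx oy; apply: oP; [exact: club_enum_le|exact: o'P].
Qed.

Lemma compress_vanish (f : C0) : exists a, forall x, (a <= x)%O -> (f \o club_enum) x = 0.
Proof.
by have [a fa] := C0_vanish f; exists a => x ax; apply: fa; apply: le_trans (le_club_enum x).
Qed.

Definition compress_fun f : C0 := mkC0 (@compress_continuous f) (compress_vanish f).

Lemma compress_bound : exists M, forall f, `|compress_fun f| <= M * `|f|.
Proof.
by exists 1 => f; rewrite mul1r; apply: C0_norm_le => x; exact: (C0_le_norm f (club_enum x)).
Qed.

Lemma compress_linear : linear compress_fun.
Proof. by move=> a f g; exact: C0_ext. Qed.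

Definition compress : 'B(C0) := mk_bop compress_linear compress_bound.

Lemma expand_continuous (g : C0) : continuous (g \o club_rank).
Proof.
move=> x; apply/(continuous_leftP omega1_min) => e e0.
have /(continuous_leftP omega1_min)/(_ _ e0)[ o [ox oP]] := @C0_continuous _ _ g (club_rank x).
exists (omap club_enum o); split.
  by case: (o) ox => //= a; rewrite club_rank_leP.
move=> y yx oy; apply: oP; first exact: club_rank_mono.
by case: (o) oy => //= a; rewrite club_rank_leP.
Qed.

Lemma expand_vanish (g : C0) : exists a, forall x, (a <= x)%O -> (g \o club_rank) x = 0.
Proof.
have [a ga] := C0_vanish g; exists (club_enum a) => x ax; apply: ga.
by rewrite -[leLHS]club_enumK club_rank_mono.
Qed.

Definition expand_fun g : C0 := mkC0 (@expand_continuous g) (expand_vanish g).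

Lemma expand_bound : exists M, forall f, `|expand_fun f| <= M * `|f|.
Proof.
by exists 1 => f; rewrite mul1r; apply: C0_norm_le => x; exact: (C0_le_norm f (club_rank x)).
Qed.

Lemma expand_linear : linear expand_fun.
Proof. by move=> a f g; exact: C0_ext. Qed.

Definition expand : 'B(C0) := mk_bop expand_linear expand_bound.

(** [compress] reads only values on [D], where [T] multiplies by [c], and it undoes [expand]. *)
Lemma compress_expand (T : 'B(C0)) c :
  (forall (f : C0) a, D a -> T f a = c * f a) ->
  bcomp compress (bcomp T expand) = c *: bid R k.
Proof.
move=> TD; apply: bop_ext => g; apply: C0_ext => x.
rewrite -[LHS]/(T (expand g) (club_enum x)) TD; last by have [] := club_enumP x.
rewrite -[expand g (club_enum x)]/(g (club_rank (club_enum x))).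
by rewrite club_enumK.
Qed.

End Factorization.

(** * The kernel of the character contains every proper ideal *)

Section MaximalIdeal.
Variables (R : realType) (k : scalars).
Local Notation K := (base_field R k).
Local Notation C0 := (C0_omega1 R k).
Local Notation kerAB := [set T : 'B(C0) | ab_character T = 0].

Lemma identity_factors (T : 'B(C0)) : ab_character T != 0 ->
  exists A B : 'B(C0), bcomp A (bcomp T B) = bid R k.
Proof.
move=> T0; have [D [cD TD]] := ab_characterP T.
exists ((ab_character T)^-1 *: compress R k cD), (expand R k cD).
have -> : bcomp ((ab_character T)^-1 *: compress R k cD) (bcomp T (expand R k cD)) =
    (ab_character T)^-1 *: bcomp (compress R k cD) (bcomp T (expand R k cD)).
  exact: bop_ext.
by rewrite (compress_expand cD TD) scalerA mulVf// scale1r.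
Qed.

Lemma ideal_ker : ideal kerAB.
Proof.
split=> /=.
- exact: ab_character0.
- by move=> S T S0 T0; rewrite ab_characterD S0 T0 addr0.
- by move=> c T T0; rewrite ab_characterZ T0 mulr0.
- by move=> S T T0; rewrite !ab_characterM T0 mulr0 mul0r.
Qed.

Lemma ideal_sub_ker (I : set 'B(C0)) : ideal I -> I <> setT -> I `<=` kerAB.
Proof.
move=> [_ _ _ IM] IT T IT'; apply: contrapT => /eqP T0; apply: IT.
have [A [B E]] := identity_factors T0.
have Iid : I (bid R k) by rewrite -E; apply: (IM A _ _).1; apply: (IM B _ _).2.
apply/seteqP; split=> // S _.
have -> : S = bcomp S (bid R k) by exact: bop_ext.
exact: (IM S _ Iid).1.
Qed.

Lemma ker_neqT : kerAB <> setT.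
Proof.
move=> e; have : kerAB (bid R k) by rewrite e.
by rewrite /= ab_character_id => /eqP; rewrite oner_eq0.
Qed.

Lemma maximal_ideal_ker : maximal_ideal kerAB.
Proof.
split; [exact: ideal_ker|exact: ker_neqT|].
move=> I idI kI; have [->|IT] := pselect (I = setT); first by right.
by left; apply/seteqP; split=> //; exact: ideal_sub_ker.
Qed.

Lemma maximal_ideal_unique (I : set 'B(C0)) : maximal_ideal I -> I = kerAB.
Proof.
move=> [idI IT Imax]; have [->//|kT] := Imax _ ideal_ker (ideal_sub_ker idI IT).
by case: ker_neqT.
Qed.

End MaximalIdeal.

(** * Hilbert-generated operators lie in the kernel *)

Section NestedConvex.
Variables (R : realType) (k : scalars).
Local Notation K := (base_field R k).
Variable H : completeNormedModType K.
Hypothesis Hip : hilbert_norm H.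

Let q (h : H) : R := modulus `|h| ^+ 2.

Let q_ge0 h : 0 <= q h. Proof. by rewrite exprn_ge0// modulus_ge0. Qed.

Lemma parallelogram (x y : H) :
  `|x + y| ^+ 2 + `|x - y| ^+ 2 = (`|x| ^+ 2 + `|y| ^+ 2) *+ 2.
Proof.
have [ip ipE] := Hip; rewrite !ipE linearBl !linearBr linearDl !linearDr.
have E (a b c d : K) : a + b + (c + d) + (a - b - (c - d)) = (a + d) *+ 2.
  rewrite opprB [a - b + _]addrACA -opprD mulr2n.
  have -> : a + b + (c + d) = (a + d) + (b + c).
    by rewrite [c + d]addrC addrACA.
  by rewrite addrACA subrr addr0.
exact: E.
Qed.

Let of_real_q h : of_real k (q h) = `|h| ^+ 2.
Proof. by rewrite /q expr2 of_realM modulusK. Qed.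

(** The parallelogram law transferred to [R]: two points are close when both are short and their
    midpoint is not much shorter. *)
Let q_mid (x y : H) : q (x - y) = (q x + q y) *+ 2 - q (2^-1 *: (x + y)) *+ 4.
Proof.
have inj : injective (of_real k : R -> K).
  move=> a b ab; apply/eqP; rewrite eq_le -!(le_of_real k) ab.
  by rewrite lexx.
have q2 : q (2^-1 *: (x + y)) *+ 4 = q (x + y).
  apply: inj; rewrite -(mulr_natl _ 4).
  have -> : 4%:R = (1 + 1) * (1 + 1) :> R by rewrite -[1 + 1]/(2%:R) -natrM.
  rewrite of_realM [in X in X * _]of_realM of_realD of_real1 !of_real_q normrZ exprMn mulrA.
  rewrite [X in X * _ = _](_ : _ = 1) ?mul1r// normfV normr_nat.
  by rewrite -expr2 -exprMn divff ?expr1n// pnatr_eq0.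
apply: inj; rewrite q2; apply: (addIr (of_real k (q (x + y)))).
rewrite -!of_realD subrK addrC of_realD !of_real_q parallelogram.
by rewrite mulr2n of_realD -mulr2n of_realD !of_real_q.
Qed.

(* Closed, bounded, nested convex sets in a Hilbert space have a common point;
   this replaces the weak compactness of the ball. *)
Lemma nested_convex (A : nat -> set H) (N : K) :
  (forall n, exists2 h, A n h & `|h| <= N) ->
  (forall m n, (m <= n)%N -> A n `<=` A m) ->
  (forall n x y, A n x -> A n y -> A n (2^-1 *: (x + y))) ->
  (forall n h, (forall e, 0 < e -> exists2 h', A n h' & `|h - h'| < e) -> A n h) ->
  exists h, forall n, A n h.
Proof.
move=> AN Adec Amid Acl.
pose a n := inf (q @` A n).
have Ainf n : has_inf (q @` A n).
  split; first by have [h Ah _] := AN n; exists (q h), h.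
  by exists 0 => _ [h _ <-].
have a_le n h : A n h -> a n <= q h by move=> Ah; apply: (ge_inf (Ainf n).2); exists h.
have N0 : 0 <= N by have [h _] := AN 0%N; apply: le_trans.
have aN n : a n <= modulus N ^+ 2.
  have [h Ah hN] := AN n; apply: le_trans (a_le n h Ah) _.
  rewrite /q lerXn2r ?nnegrE ?modulus_ge0// le_modulus normr_id.
  by rewrite (ger0_norm N0).
have Sa : has_sup (range a).
  by split; [exists (a 0%N), 0%N|exists (modulus N ^+ 2) => _ [n _ <-]].
pose s := sup (range a).
have a_s n : a n <= s by apply: (ub_le_sup Sa.2); exists n.
(* Near-minimisers of the norm: [a n] is the squared distance from the origin to [A n], and [s] is
   the supremum of these. The sets [B n] generate a Cauchy filter whose limit is the common
   point. *)
pose B n := [set h | A n h /\ q h < s + n.+1%:R^-1].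
have Bdec m n : (m <= n)%N -> B n `<=` B m.
  move=> mn h [Ah qh]; split; first exact: Adec Ah.
  by apply: lt_le_trans qh _; rewrite lerD2l lef_pV2 ?posrE ?ltr0n// ler_nat.
have B0 n : B n !=set0.
  have e0 : 0 < n.+1%:R^-1 :> R by rewrite invr_gt0 ltr0n.
  have [_ [h Ah <-] qh] := inf_adherent e0 (Ainf n).
  by exists h; split => //; apply: (lt_le_trans qh); rewrite lerD2r; exact: a_s.
pose F := filter_from setT B.
have FF : ProperFilter F.
  apply: filter_from_proper; last by move=> n _; exact: B0.
  apply: filter_fromT_filter; first by exists 0%N.
  move=> i j; exists (maxn i j) => h Bh.
  by split; apply: Bdec Bh; [exact: leq_maxl|exact: leq_maxr].
have /cauchy_cvg Fc : cauchy F.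
  apply/cauchy_exP => e e0.
  have m0 : 0 < modulus e by rewrite -(lt_of_real k) of_real0 modulusK// ltW.
  (* With [q x], [q y] below [s + d] and the midpoint above [s - d], [q_mid] gives a squared
     distance below 4(s + d) - 4(s - d) = 8d. *)
  pose d := modulus e ^+ 2 / 8; have d0 : 0 < d by rewrite divr_gt0// exprn_gt0.
  have [_ [n1 _ <-] an1] := sup_adherent d0 Sa.
  have [n2 n2P] : exists n, n.+1%:R^-1 < d.
    exists (Num.bound d^-1); rewrite invf_plt ?posrE ?ltr0n//.
    by rewrite (lt_trans (archi_boundP _)) ?invr_ge0 ?ltW// ltr_nat.
  pose n := maxn n1 n2; have [x Bx] := B0 n.
  exists x, n => // y By.
  have Ax := (Bdec n1 n (leq_maxl _ _) x Bx).1.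
  have Ay := (Bdec n1 n (leq_maxl _ _) y By).1.
  have qx := (Bdec n2 n (leq_maxr _ _) x Bx).2.
  have qy := (Bdec n2 n (leq_maxr _ _) y By).2.
  have qm := a_le n1 _ (Amid _ _ _ Ax Ay).
  rewrite /= -ball_normE /= -(modulusK (ltW e0)) -(modulusK (normr_ge0 (x - y))).
  rewrite lt_of_real -(@ltr_pXn2r _ 2%N)// ?nnegrE ?modulus_ge0// -[ltLHS]/(q (x - y)) q_mid.
  have -> : modulus e ^+ 2 = d * 8%:R by rewrite divfK// pnatr_eq0.
  move: an1 qx qy qm n2P; rewrite -/s; move: (q x) (q y) (q (_ *: _)) (a n1) (n2.+1%:R^-1).
  move=> qx qy qm an1 z h1 h2 h3 h4 h5; lra.
exists (lim F) => n; apply: Acl => e e0.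
have /fcvgrPdist_lt/(_ e e0)[m _ mP] := Fc.
have [h Bh] := B0 (maxn m n); exists h.
  exact: (Bdec n _ (leq_maxr _ _) h Bh).1.
exact: mP (Bdec m _ (leq_maxl _ _) h Bh).
Qed.

End NestedConvex.

Section HilbertGeneratedSubKer.
Variables (R : realType) (k : scalars).
Local Notation K := (base_field R k).
Local Notation C0 := (C0_omega1 R k).

Lemma hilbert_generated_sub_ker (T : 'B(C0)) :
  hilbert_generated C0 C0 T -> ab_character T = 0.
Proof.
move=> [H [Hip [S TS]]]; have [D [cD TD]] := ab_characterP T.
set c := ab_character T in TD *; apply/eqP/negPn/negP => c0.
(* Three errors of size [r] will be collected, at a point [u m], across the jump and at [s]; a
   fourth [r] would be required to reach [|c|]. *)
pose r := `|c| / 4; have r0 : 0 < r by rewrite divr_gt0// normr_gt0.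
(* Every point of [D] lies in some [A N], so a single [N] serves unboundedly many points. *)
pose A (N : nat) := [set a | D a /\ exists2 h, `|h| <= N%:R & `|T (ind0 R k a) - S h| < r].
have [N AN] : exists N, forall a, exists2 b, A N b & (a <= b)%O.
  apply: unbounded_tail => a; have [b Db ab] := cD.2 a; exists b => //.
  have Tb : range T (T (ind0 R k b)) by exists (ind0 R k b).
  have [_ [[h _ <-] hb]] := TS _ Tb _ (nbhsx_ballx (T (ind0 R k b)) r r0).
  have [n nP] : exists n : nat, n.+1%:R^-1 < (`|h| + 1)^-1.
    by apply: archi_inv; rewrite invr_gt0 ltr_wpDl.
  exists n.+1 => //; split=> //; exists h; last by move: hb; rewrite -ball_normE.
  have h1 : 0 < `|h| + 1 by rewrite ltr_wpDl.
  move: nP; rewrite ltf_pV2 ?posrE ?ltr0n// => /ltW; apply: le_trans.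
  by rewrite lerDl.
have [u [uA uS]] := unbounded_increasing AN.
have [s [us sP]] := increasing_sup uS.
have Ds : D s by apply: (closed_sup cD.1 (fun n => (uA n).1)).
(* [T (ind0 (u n))] equals [c] at [u 0], ..., [u n] and 0 at the supremum [s], so its approximate
   preimage lies in [B n]. An [h] in all the [B n] keeps [S h] near [c] along the whole sequence but
   near 0 at its limit [s]. *)
pose B n := [set h | (forall m, (m <= n)%N -> `|S h (u m) - c| <= r) /\ `|S h s| <= r].
have [||||h hB] := @nested_convex _ _ H Hip B N%:R.
- move=> n; have [_ [h hN hr]] := uA n; exists h => //; split=> [m mn|].
    have -> : c = T (ind0 R k (u n)) (u m).
      by rewrite TD ?ind0E ?(seq_mono uS)// ?mulr1//; exact: (uA m).1.
    rewrite distrC; apply: le_trans (ltW hr).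
    exact: (C0_le_norm (T (ind0 R k (u n)) - S h)).
  have -> : S h s = - (T (ind0 R k (u n)) s - S h s).
    by rewrite TD// ind0E leNgt us mulr0 sub0r opprK.
  rewrite normrN; apply: le_trans (ltW hr).
  exact: (C0_le_norm (T (ind0 R k (u n)) - S h)).
- move=> m n mn h [h1 h2]; split=> // j jm; apply: h1; exact: leq_trans mn.
- move=> n x y [x1 x2] [y1 y2].
  have ev z : S (2^-1 *: (x + y)) z = (S x z + S y z) / 2.
    by rewrite linearZ linearD mulrC.
  have mid a b : `|a| <= r -> `|b| <= r -> `|(a + b) / 2| <= r.
    move=> ar br; rewrite normrM normfV normr_nat ler_pdivrMr// mulr_natr mulr2n.
    by rewrite (le_trans (ler_normD _ _))// lerD.
  split=> [m mn|]; rewrite ev; last exact: mid.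
  have -> : (S x (u m) + S y (u m)) / 2 - c = ((S x (u m) - c) + (S y (u m) - c)) / 2.
    rewrite addrACA -opprD [RHS]mulrDl mulNr; congr (_ - _).
    by rewrite -mulr2n -(mulr_natr c 2) mulfK// pnatr_eq0.
  by apply: mid; [exact: x1|exact: y1].
- move=> n h hcl; have [M M0 SM] := bop_bounded_ge0 S.
  have key z d : (forall e, 0 < e -> exists2 h', `|S h' z - d| <= r & `|h - h'| < e) ->
      `|S h z - d| <= r.
    move=> hz; apply: le_eps; rewrite ?normr_real ?gtr0_real// => e e0.
    have M1 : 0 < M + 1 by rewrite ltr_wpDl.
    have [h' h'r hh'] := hz (e / (M + 1)) (divr_gt0 e0 M1).
    rewrite [r + e]addrC -(subrKA (S h' z)) (le_trans (ler_normD _ _))// lerD//.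
    have -> : S h z - S h' z = S (h - h') z by rewrite linearB.
    apply: le_trans (C0_le_norm (S (h - h')) z) _; apply: le_trans (SM _) _.
    apply: (@le_trans _ _ (M * (e / (M + 1)))); first by rewrite ler_wpM2l// ltW.
    by rewrite mulrCA ger_pMr// ler_pdivrMr// mul1r lerDl.
  split=> [m mn|]; last rewrite -[S h s]subr0; apply: key => e /hcl[h' [h1 h2] hh'].
    by exists h' => //; exact: h1.
  by exists h' => //; rewrite subr0.
have /(continuous_leftP omega1_min)/(_ _ r0)[ o [ox oP]] := @C0_continuous _ _ (S h) s.
have [m om] : exists m, ~~ below o (u m).
  case: o ox {oP} => [a|_]; last by exists 0%N.
  by rewrite /= -ltNge => /sP[m am]; exists m; rewrite -ltNge.
have h1 := (hB m).1 m (leqnn m); have h2 := (hB m).2.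
have h3 := oP _ (ltW (us m)) om.
have : `|c| < r + r + r.
  have -> : c = (c - S h (u m)) + ((S h (u m) - S h s) + S h s).
    by rewrite addrA subrKA subrK.
  rewrite distrC in h1; rewrite distrC in h3.
  rewrite (le_lt_trans (ler_normD _ _))// -[r + r + r]addrA ler_ltD//.
  by rewrite (le_lt_trans (ler_normD _ _))// ltr_leD.
have -> : `|c| = r + r + r + r.
  by rewrite -[LHS](divfK (_ : 4 != 0)) ?pnatr_eq0// mulr_natr -/r !mulrS mulr0n addr0 !addrA.
by rewrite gtrDl => /(lt_trans r0); rewrite ltxx.
Qed.

End HilbertGeneratedSubKer.

(** * The Hilbert space l_2(I) *)

Section Minkowski.
Variables (R : realType) (k : scalars) (I : choiceType).
Local Notation K := (base_field R k).
Implicit Types (A : {fset I}) (f g : I -> K).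

Definition sqsum f A : R := \sum_(i <- A) modulus (f i) ^+ 2.

Lemma sqsum_ge0 f A : 0 <= sqsum f A.
Proof. by apply: sumr_ge0 => i _; rewrite exprn_ge0// modulus_ge0. Qed.

Lemma le_sqsum f A i : i \in A -> modulus (f i) ^+ 2 <= sqsum f A.
Proof.
move=> iA; rewrite /sqsum (big_fsetD1 i)//= lerDl.
exact: sqsum_ge0.
Qed.

(* (a + b)^2 <= (p + q) (a^2 / p + b^2 / q) *)
Lemma minkowski f g A p q : 0 < p -> 0 < q ->
  sqsum f A <= p ^+ 2 -> sqsum g A <= q ^+ 2 -> sqsum (f \+ g) A <= (p + q) ^+ 2.
Proof.
move=> p0 q0 fp gq.
have key (a b : R) : (a + b) ^+ 2 <= (p + q) * (a ^+ 2 / p + b ^+ 2 / q).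
  rewrite -subr_ge0.
  have -> : (p + q) * (a ^+ 2 / p + b ^+ 2 / q) - (a + b) ^+ 2 =
      (q * a - p * b) ^+ 2 / (p * q).
    by field; rewrite !gt_eqF.
  by rewrite divr_ge0 ?sqr_ge0// mulr_ge0// ltW.
apply: (@le_trans _ _ ((p + q) * (sqsum f A / p + sqsum g A / q))).
  rewrite /sqsum !mulr_suml -big_split mulr_sumr /=.
  apply: ler_sum => i _; apply: le_trans (key _ _).
  by rewrite lerXn2r ?nnegrE ?addr_ge0 ?modulus_ge0// modulusD.
rewrite expr2 ler_pM2l ?addr_gt0// lerD// ler_pdivrMr//.
Qed.

End Minkowski.

Section L2.
Variables (R : realType) (k : scalars) (I : choiceType).
Local Notation K := (base_field R k).

Definition l2_pred : {pred I -> K} :=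
  [pred f | `[< exists M, forall A, sqsum f A <= M >]].

Lemma l2_submod_closed : submod_closed l2_pred.
Proof.
split.
  apply/asboolP; exists 0 => A; rewrite /sqsum big1// => i _.
  by rewrite /= modulus0 expr0n.
move=> c f g /asboolP[M fM] /asboolP[N gN]; apply/asboolP.
have M0 : 0 <= M by apply: le_trans (fM fset0); exact: sqsum_ge0.
have N0 : 0 <= N by apply: le_trans (gN fset0); exact: sqsum_ge0.
(* [M <= (M + 1)^2] turns the bounds into squares, as [minkowski] expects; the last [+ 1] keeps [p]
   positive when [c = 0]. *)
pose p := modulus c * (M + 1) + 1; pose q := N + 1.
have p0 : 0 < p by rewrite ltr_wpDl// mulr_ge0 ?modulus_ge0// addr_ge0.
exists ((p + q) ^+ 2) => A; apply: (@minkowski _ _ _ (c *: f) g A p q) => //.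
- by rewrite ltr_wpDl.
- have -> : sqsum (c *: f) A = modulus c ^+ 2 * sqsum f A.
    by rewrite /sqsum mulr_sumr; apply: eq_bigr => i _; rewrite -exprMn -modulusM.
  apply: (@le_trans _ _ ((modulus c * (M + 1)) ^+ 2)).
    rewrite exprMn ler_wpM2l ?exprn_ge0 ?modulus_ge0//; apply: le_trans (fM A) _.
    nra.
  have q0 : 0 <= modulus c * (M + 1) by rewrite mulr_ge0 ?modulus_ge0 ?addr_ge0.
  by rewrite ler_pXn2r ?nnegrE ?(ltW p0)// /p lerDl.
- by apply: le_trans (gN A) _; rewrite /q; nra.
Qed.

HB.instance Definition _ :=
  GRing.isSubmodClosed.Build K (I -> K) l2_pred l2_submod_closed.

Record l2 := MkL2 { l2_fun :> I -> K; _ : l2_fun \in l2_pred }.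

HB.instance Definition _ := [isSub for l2_fun].
HB.instance Definition _ := [Choice of l2 by <:].
HB.instance Definition _ := [SubChoice_isSubLmodule of l2 by <:].

Implicit Types (f g h : l2) (A : {fset I}).

Lemma l2_ext f g : (forall i, f i = g i) -> f = g.
Proof. by move=> E; apply: val_inj; apply/funext. Qed.

Lemma l2_bounded f : exists M, forall A, sqsum f A <= M.
Proof. by case: f => f /= /asboolP. Qed.

Definition nsq f : R := sup (range (sqsum f)).

Let has_sup_sqsum f : has_sup (range (sqsum f)).
Proof.
split; first by exists (sqsum f fset0), fset0.
by have [M fM] := l2_bounded f; exists M => _ [A _ <-].
Qed.

Lemma le_nsq f A : sqsum f A <= nsq f.
Proof. by apply: sup_upper_bound => //; exists A. Qed.

Lemma nsq_le f M : (forall A, sqsum f A <= M) -> nsq f <= M.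
Proof.
move=> fM; apply: ge_sup; first by exists (sqsum f fset0), fset0.
by move=> _ [A _ <-].
Qed.

Lemma nsq_ge0 f : 0 <= nsq f.
Proof. by apply: le_trans (le_nsq f fset0); exact: sqsum_ge0. Qed.

Lemma nsq_adherent f e : 0 < e -> exists A, nsq f - e < sqsum f A.
Proof. by move=> e0; have [_ [A _ <-] h] := sup_adherent e0 (has_sup_sqsum f); exists A. Qed.

Definition l2_norm f : K := of_real k (Num.sqrt (nsq f)).

Lemma nsqD f g p q : 0 < p -> 0 < q -> nsq f <= p ^+ 2 -> nsq g <= q ^+ 2 ->
  nsq (f + g) <= (p + q) ^+ 2.
Proof.
move=> p0 q0 fp gq; apply: nsq_le => A; apply: (@minkowski _ _ _ f g) => //.
  exact: le_trans (le_nsq f A) fp.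
exact: le_trans (le_nsq g A) gq.
Qed.

Lemma ler_l2_normD f g : l2_norm (f + g) <= l2_norm f + l2_norm g.
Proof.
rewrite -of_realD le_of_real; apply/ler_addgt0Pr => e e0.
have e2 : 0 < e / 2 by rewrite divr_gt0.
set a := Num.sqrt (nsq f); set b := Num.sqrt (nsq g).
have a0 : 0 <= a by exact: sqrtr_ge0.
have b0 : 0 <= b by exact: sqrtr_ge0.
(* The summands [e / 2] make both bounds strictly positive, which covers elements of norm zero. *)
have := @nsqD f g (a + e / 2) (b + e / 2) (ltr_wpDl a0 e2) (ltr_wpDl b0 e2) _ _.
have -> : a + e / 2 + (b + e / 2) = a + b + e by rewrite addrACA -splitr.
move=> h; rewrite -[leRHS]ger0_norm; last by rewrite !addr_ge0// ltW.
rewrite -sqrtr_sqr; apply: ler_wsqrtr; apply: h.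
- rewrite -[leLHS]sqr_sqrtr ?nsq_ge0// -/a.
  by rewrite ler_pXn2r ?nnegrE// ?lerDl ?(ltW e2)// addr_ge0// ltW.
- rewrite -[leLHS]sqr_sqrtr ?nsq_ge0// -/b.
  by rewrite ler_pXn2r ?nnegrE// ?lerDl ?(ltW e2)// addr_ge0// ltW.
Qed.

Lemma sqsumZ (c : K) f A : sqsum (c *: f) A = modulus c ^+ 2 * sqsum f A.
Proof.
rewrite /sqsum mulr_sumr; apply: eq_bigr => i _; rewrite -exprMn -modulusM.
by [].
Qed.

Lemma nsqZ (c : K) f : nsq (c *: f) = modulus c ^+ 2 * nsq f.
Proof.
have le1 (a : K) g : nsq (a *: g) <= modulus a ^+ 2 * nsq g.
  apply: nsq_le => A; rewrite sqsumZ ler_wpM2l ?exprn_ge0 ?modulus_ge0//.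
  exact: le_nsq.
apply/le_anti; rewrite le1/=; have [->|c0] := eqVneq c 0.
  by rewrite modulus0 expr0n mul0r nsq_ge0.
have mc : 0 < modulus c by rewrite -(lt_of_real k) of_real0 of_real_modulus normr_gt0.
rewrite -ler_pdivlMl ?exprn_gt0//.
have := le1 c^-1 (c *: f); rewrite scalerA mulVf// scale1r; congr (_ <= _ * _).
rewrite -exprVn; congr (_ ^+ _); apply: (mulfI (lt0r_neq0 mc)).
rewrite -modulusM divff// divff ?gt_eqF//.
by rewrite -(of_real1 R k) of_realK ?ler01.
Qed.

Lemma l2_normZ (c : K) f : l2_norm (c *: f) = `|c| * l2_norm f.
Proof.
rewrite /l2_norm nsqZ sqrtrM ?exprn_ge0 ?modulus_ge0// of_realM sqrtr_sqr.
by rewrite ger0_norm ?modulus_ge0// of_real_modulus.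
Qed.

Lemma l2_norm_eq0 f : l2_norm f = 0 -> f = 0.
Proof.
move=> /(congr1 (@modulus R k)); rewrite of_realK ?sqrtr_ge0// modulus0 => /eqP.
rewrite sqrtr_eq0 => f0; apply: l2_ext => i /=; apply/eqP.
rewrite -normr_le0 -of_real_modulus -(of_real0 R k) le_of_real.
rewrite -(@ler_pXn2r _ 2)// ?nnegrE ?modulus_ge0// expr0n /=.
apply: le_trans (le_sqsum f (fset11 i)) _; exact: le_trans (le_nsq _ _) f0.
Qed.

HB.instance Definition _ := Lmodule_isNormed.Build K l2
  ler_l2_normD l2_normZ l2_norm_eq0.

Lemma l2_normE f : `|f| = l2_norm f. Proof. by []. Qed.

Lemma nsqE f : of_real k (nsq f) = `|f| ^+ 2.
Proof. by rewrite l2_normE expr2 -of_realM -expr2 sqr_sqrtr// nsq_ge0. Qed.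

Lemma le_coord f i : `|f i| <= `|f|.
Proof.
rewrite l2_normE -of_real_modulus le_of_real -[leLHS]ger0_norm ?modulus_ge0//.
rewrite -sqrtr_sqr ler_wsqrtr//.
exact: le_trans (le_sqsum f (fset11 i)) (le_nsq _ _).
Qed.

Lemma nsq_lt f (e : R) : 0 <= e -> `|f| < of_real k e -> nsq f < e ^+ 2.
Proof.
move=> e0; rewrite l2_normE lt_of_real => h.
rewrite -[ltLHS]sqr_sqrtr ?nsq_ge0// ltr_pXn2r// ?nnegrE ?sqrtr_ge0//.
Qed.

Lemma norm_le_nsq f (e : R) : 0 <= e -> nsq f <= e ^+ 2 -> `|f| <= of_real k e.
Proof.
move=> e0 h; rewrite l2_normE le_of_real -[leRHS]ger0_norm// -sqrtr_sqr.
exact: ler_wsqrtr.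
Qed.

Lemma mkL2_subproof (f : I -> K) M : (forall A, sqsum f A <= M) -> f \in l2_pred.
Proof. by move=> fM; apply/asboolP; exists M. Qed.

Definition mkL2 (f : I -> K) M (fM : forall A, sqsum f A <= M) : l2 :=
  MkL2 (mkL2_subproof fM).

Lemma l2_complete (F : set_system l2) : ProperFilter F -> cauchy F -> cvg F.
Proof.
move=> FF /cauchyP Fc.
have Fc' (e : R) : 0 < e -> exists f, F [set h | `|f - h| < of_real k e].
  move=> e0; have e0' : 0 < of_real k e by rewrite -of_real0 lt_of_real.
  by have [f Ff] := Fc _ e0'; exists f; move: Ff; rewrite -ball_normE.
have /choice[g gP] : forall i, exists l : K, (fun f : l2 => f i) @ F --> l.
  move=> i; apply: base_field_complete => e e0.
  have m0 : 0 < modulus e by rewrite -(lt_of_real k) of_real0 modulusK// ltW.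
  have [f Ff] := Fc' _ m0; exists (f i).
  rewrite modulusK ?ltW// in Ff.
  suff : F [set h : l2 | `|f i - h i| < e] by [].
  apply: (filterS _ Ff) => h /=; apply: le_lt_trans.
  exact: (le_coord (f - h) i).
have key f (e : R) : 0 < e -> F [set h | `|f - h| < of_real k e] ->
    forall A, sqsum (fun i => f i - g i) A <= (e + e) ^+ 2.
  (* Chosen so that the sum of [d^2] over [A] is at most [e^2]. The estimate compares [f] with an
     [h] of the filter that is [d]-close to [g] on the finite set [A]. *)
  move=> e0 Ff A; pose d := e / (size A).+1%:R.
  have d0 : 0 < d by rewrite divr_gt0// ltr0n.
  have [h [fh hg]] : exists h, `|f - h| < of_real k e /\
      forall i, i \in (A : seq I) -> `|h i - g i| <= of_real k d.
    apply: (@filter_ex _ F); apply: filterI => //.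
    elim: (A : seq I) => [|a s IH]; first by apply: filterS filterT.
    have d0' : 0 < of_real k d by rewrite -of_real0 lt_of_real.
    have /cvgrPdist_lt/(_ _ d0') ha := gP a.
    apply: filterS2 ha IH => h /= ha IH i; rewrite inE => /predU1P[->|/IH//].
    by rewrite distrC ltW.
  have -> : (fun i => f i - g i) = (fun i => (f - h) i) \+ (fun i => h i - g i).
    by apply/funext => i /=; rewrite subrKA.
  apply: minkowski => //.
    by apply: le_trans (le_nsq (f - h) A) _; apply/ltW/nsq_lt => //; exact: ltW.
  apply: (@le_trans _ _ (\sum_(i <- A) d ^+ 2)).
    rewrite /sqsum big_seq [leRHS]big_seq; apply: ler_sum => i /hg.
    rewrite -of_real_modulus le_of_real => hd.
    by rewrite lerXn2r ?nnegrE ?modulus_ge0// ltW.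
  rewrite big_const_seq count_predT iter_addr_0 -[_ *+ _]mulr_natl expr_div_n.
  rewrite mulrCA ger_pMr ?exprn_gt0// ler_pdivrMr ?exprn_gt0 ?ltr0n// mul1r.
  by rewrite -natrX ler_nat -mulnn mulSn ltnW// ltnS leq_addr.
have [f1 f1P] := Fc' 1 ltr01.
(* The pointwise limit [g] is not yet known to be square summable, but [f1 - g] is, by [key]; hence
   the detour through [f1]. *)
pose G : l2 := f1 - mkL2 (key _ _ ltr01 f1P).
have GE i : G i = g i by rewrite -[LHS]/(f1 i - (f1 i - g i)) subKr.
apply/cvg_ex; exists G; apply/fcvgrPdist_lt => e e0.
have m0 : 0 < modulus e / 4 by rewrite divr_gt0// -(lt_of_real k) of_real0 modulusK// ltW.
have [f Ff] := Fc' _ m0; apply: filterS (Ff) => h /= fh.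
rewrite -(subrKA f) (le_lt_trans (ler_normD _ _))//.
have Gf : `|G - f| <= of_real k (modulus e / 4 + modulus e / 4).
  rewrite distrC; apply: norm_le_nsq; first by rewrite addr_ge0// ltW.
  apply: nsq_le => A; apply: le_trans (key f _ m0 Ff A).
  rewrite le_eqVlt; apply/orP; left; apply/eqP; congr (sqsum _ A).
  by apply/funext => i; rewrite -[LHS]/(f i - G i) GE.
apply: lt_le_trans (ler_ltD Gf fh) _.
rewrite -of_realD -[leRHS](modulusK (ltW e0)) le_of_real.
move: m0; set m := modulus e; lra.
Qed.

HB.instance Definition _ := Uniform_isComplete.Build l2 l2_complete.

End L2.

Section ScalarConj.
Variables (R : realType) (k : scalars).
Local Notation K := (base_field R k).

Lemma norm_conj_scalar (z : K) : `|conj_scalar R k z| = `|z|.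
Proof. by move: z; rewrite /conj_scalar; case: k => z //=; rewrite norm_conjC. Qed.

Lemma mul_conj_scalar (z : K) : z * conj_scalar R k z = `|z| ^+ 2.
Proof.
move: z; rewrite /conj_scalar; case: k => z /=; last by rewrite normCK.
by rewrite -normrX ger0_norm ?sqr_ge0.
Qed.

Lemma conj_scalarK (z : K) : conj_scalar R k (conj_scalar R k z) = z.
Proof. by move: z; rewrite /conj_scalar; case: k => z //=; rewrite conjCK. Qed.

End ScalarConj.

Section InnerProduct.
Variables (R : realType) (k : scalars) (I : choiceType).
Local Notation K := (base_field R k).
Local Notation H := (l2 R k I).
Local Notation conj := (conj_scalar R k).
Implicit Types (f g h : H) (A : {fset I}).

(** The crude inequality [a b <= a^2 + b^2] already gives the absolute convergence on which [ip]
    rests. *)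
Lemma ip_bounded f g A : \sum_(i <- A) `|f i * conj (g i)| <= of_real k (nsq f + nsq g).
Proof.
apply: (@le_trans _ _ (of_real k (sqsum f A + sqsum g A))); last first.
  by rewrite le_of_real lerD// le_nsq.
rewrite -big_split of_real_sum; apply: ler_sum => i _.
rewrite normrM norm_conj_scalar -!of_real_modulus -of_realM le_of_real.
have := modulus_ge0 (f i); have := modulus_ge0 (g i).
move: (modulus _) (modulus _) => a b a0 b0 /=; nra.
Qed.

Definition ip f g : K := sval (cid (net_sum_ex (ip_bounded f g))).

Lemma ipP f g : net_sum (fun i => f i * conj (g i)) (ip f g).
Proof. exact: (svalP (cid (net_sum_ex (ip_bounded f g)))). Qed.

Lemma ip_eq f g s : net_sum (fun i => f i * conj (g i)) s -> ip f g = s.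
Proof. by move=> gs; exact: (net_sum_unique (@ipP f g) gs). Qed.

Lemma ipC f g : ip f g = conj (ip g f).
Proof.
apply: ip_eq; apply/net_sumP => e e0.
have /net_sumP/(_ e e0)[A AP] := @ipP g f; exists A => B /AP.
rewrite -[X in X < _ -> _]norm_conj_scalar rmorphB rmorph_sum.
under eq_bigr do rewrite rmorphM conj_scalarK mulrC.
by [].
Qed.

Lemma ipDl f g h : ip (f + g) h = ip f h + ip g h.
Proof.
apply: ip_eq; have := net_sumD (@ipP f h) (@ipP g h).
by congr (net_sum _ _); apply/funext => i /=; rewrite mulrDl.
Qed.

Lemma ipZl (c : K) f h : ip (c *: f) h = c * ip f h.
Proof.
apply: ip_eq; have := @net_sumZ _ _ _ c _ _ (@ipP f h).
by congr (net_sum _ _); apply/funext => i /=; rewrite mulrA.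
Qed.

Lemma ip_norm f : ip f f = `|f| ^+ 2.
Proof.
rewrite -nsqE; apply: ip_eq; apply/net_sumP => e e0.
have m0 : 0 < modulus e by rewrite -(lt_of_real k) of_real0 modulusK// ltW.
have [A AP] := nsq_adherent f m0; exists A => B AB.
have -> : \sum_(i <- B) f i * conj (f i) = of_real k (sqsum f B).
  rewrite of_real_sum; apply: eq_bigr => i _.
  by rewrite mul_conj_scalar expr2 of_realM of_real_modulus.
have -> : of_real k (nsq f) - of_real k (sqsum f B) = of_real k (nsq f - sqsum f B).
  by apply/eqP; rewrite subr_eq -of_realD subrK.
have h : 0 <= nsq f - sqsum f B by rewrite subr_ge0 le_nsq.
rewrite -of_real_modulus of_realK// -[ltRHS](modulusK (ltW e0)) lt_of_real.
rewrite ltrBlDr -ltrBlDl; apply: lt_le_trans AP _.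
by rewrite {2}/sqsum (sum_fsetD _ AB) lerDl; exact: sqsum_ge0.
Qed.

Lemma ip_zmodl h : zmod_morphism (ip^~ h).
Proof. by move=> f g /=; rewrite -scaleN1r ipDl ipZl mulN1r. Qed.

Lemma ip_zmodr h : zmod_morphism (ip h).
Proof. by move=> f g; rewrite ipC ip_zmodl rmorphB -!ipC. Qed.

Lemma ip_scalel h : scalable_for *%R (ip^~ h).
Proof. by move=> c f; exact: ipZl. Qed.

Lemma ip_scaler h : scalable_for (conj \; *%R) (ip h).
Proof. by move=> c f; rewrite ipC ipZl rmorphM -ipC. Qed.

HB.instance Definition _ := isBilinear.Build K H H K *%R (conj \; *%R) ip
  ip_zmodl ip_zmodr ip_scalel ip_scaler.

Lemma ip_herm f g : ip f g = (-1) ^+ false * conj (ip g f).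
Proof. by rewrite expr0 mul1r ipC. Qed.

HB.instance Definition _ := isHermitianSesquilinear.Build K H false conj ip ip_herm.

Lemma ip_gt0 f : f != 0 -> 0 < ip f f.
Proof. by move=> f0; rewrite ip_norm exprn_gt0// normr_gt0. Qed.

HB.instance Definition _ := isDotProduct.Build K H ip ip_gt0.

Lemma l2_hilbert_norm : @hilbert_norm R k H.
Proof. by exists (ip : {dot H for conj}) => h; rewrite -ip_norm. Qed.

End InnerProduct.

(** * Operators in the kernel are Hilbert-generated *)

Section SumOperator.
Variables (R : realType) (k : scalars) (I : choiceType).
Local Notation K := (base_field R k).
Local Notation H := (l2 R k I).
Local Notation C0 := (C0_omega1 R k).
Local Notation W := omega1.
Implicit Types (h : H) (A B : {fset I}).

(** Eventual vanishing survives uniform limits because the thresholds for the tolerances 1/(n+1)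
    have a common bound. *)
Lemma C0_uniform (f : W -> K) :
  (forall e, 0 < e -> exists g : C0, forall x, `|f x - g x| <= e) ->
  continuous f /\ exists a, forall x, (a <= x)%O -> f x = 0.
Proof.
move=> fg; split.
  move=> x; apply/(continuous_leftP omega1_min) => e e0.
  have e3 : 0 < e / 3 by rewrite divr_gt0.
  have [g gP] := fg _ e3.
  have /(continuous_leftP omega1_min)/(_ _ e3)[ o [ox oP]] := @C0_continuous _ _ g x.
  exists o; split=> // y yx oy.
  have -> : f x - f y = (f x - g x) + ((g x - g y) + (g y - f y)).
    by rewrite addrA !subrKA.
  have -> : e = e / 3 + (e / 3 + e / 3).
    by rewrite -!mulrDl -mulr2n -mulrS -(mulr_natr e 3) mulfK// pnatr_eq0.
  rewrite (le_lt_trans (ler_normD _ _))// ler_ltD//.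
  rewrite (le_lt_trans (ler_normD _ _))// ltr_leD//; first exact: oP.
  by rewrite distrC.
have /choice[u uP] : forall n : nat, exists a : W, forall x, (a <= x)%O ->
    `|f x| <= n.+1%:R^-1.
  move=> n; have e0 : 0 < n.+1%:R^-1 :> K by rewrite invr_gt0 ltr0n.
  have [g gP] := fg _ e0; have [a ga] := C0_vanish g.
  by exists a => x /ga gx; have := gP x; rewrite gx subr0.
have [a ua] := seq_ub u; exists a => x ax.
apply: norm_small0 => n; apply: uP.
exact: le_trans (ltW (ua n)) ax.
Qed.

Variable phi : I -> C0.
Hypothesis phi1 : forall x A, \sum_(i <- A) `|phi i x| <= 1.

Lemma sum_op_bounded h x A : \sum_(i <- A) `|h i * phi i x| <= `|h|.
Proof.
apply: (@le_trans _ _ (\sum_(i <- A) `|h| * `|phi i x|)).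
  by apply: ler_sum => i _; rewrite normrM ler_wpM2r// le_coord.
by rewrite -mulr_sumr ler_piMr.
Qed.

Definition sum_op_val h (x : W) : K := sval (cid (net_sum_ex (sum_op_bounded h x))).

Lemma sum_op_valP h x : net_sum (fun i => h i * phi i x) (sum_op_val h x).
Proof. exact: (svalP (cid (net_sum_ex (sum_op_bounded h x)))). Qed.

(** Outside a finite set the coordinates of [h] are at most [e], and [phi1] bounds the rest of the
    sum by [e] at every [x] simultaneously. *)
Lemma sum_op_uniform h e : 0 < e -> exists g : C0, forall x, `|sum_op_val h x - g x| <= e.
Proof.
move=> e0.
have m0 : 0 < modulus e ^+ 2 by rewrite exprn_gt0// -(lt_of_real k) of_real0 modulusK// ltW.
have [A AP] := tail_lt (fun i => exprn_ge0 2 (modulus_ge0 (h i))) (le_nsq h) m0.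
have small i : i \notin A -> `|h i| <= e.
  move=> iA; rewrite -(ger0_norm (ltW e0)) -le_modulus.
  rewrite -(@ler_pXn2r _ 2)// ?nnegrE ?modulus_ge0//.
  have := AP [fset i]%fset; rewrite fdisjointX1 iA big_seq_fset1 => /(_ isT)/ltW.
  exact.
exists (\sum_(i <- A) h i *: phi i) => x.
have -> : (\sum_(i <- A) h i *: phi i) x = \sum_(i <- A) h i * phi i x.
  by rewrite C0_sum_apply.
apply: le_eps; rewrite ?normr_real ?gtr0_real// => d d0.
have /net_sumP/(_ d d0)[B BP] := @sum_op_valP h x.
have AAB : (A `<=` A `|` B)%fset by exact: fsubsetUl.
have := BP (A `|` B)%fset (fsubsetUr _ _); set S := \sum_(i <- (A `|` B)%fset) _ => SP.
rewrite [e + d]addrC -(subrKA S) (le_trans (ler_normD _ _))// lerD//; first exact: ltW.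
rewrite /S (sum_fsetD _ AAB) addrAC subrr add0r (le_trans (ler_norm_sum _ _ _))//.
apply: (@le_trans _ _ (\sum_(i <- ((A `|` B) `\` A)%fset) e * `|phi i x|)).
  rewrite big_seq [leRHS]big_seq; apply: ler_sum => i; rewrite !inE => /andP[iA _].
  by rewrite normrM ler_wpM2r// small.
by rewrite -mulr_sumr ler_piMr// ltW.
Qed.

Definition sum_op_fun h : C0 :=
  mkC0 (C0_uniform (@sum_op_uniform h)).1 (C0_uniform (@sum_op_uniform h)).2.

Lemma sum_op_linear : linear sum_op_fun.
Proof.
move=> a f g; apply: C0_ext => x.
apply: (net_sum_unique (@sum_op_valP (a *: f + g) x)).
have := net_sumD (@net_sumZ _ _ _ a _ _ (@sum_op_valP f x)) (@sum_op_valP g x).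
congr (net_sum _ _); apply/funext => i /=.
rewrite -[RHS]/((a * f i + g i) * phi i x).
by rewrite mulrDl mulrA.
Qed.

Lemma sum_op_bound : exists M, forall h, `|sum_op_fun h| <= M * `|h|.
Proof.
exists 1 => h; rewrite mul1r; apply: C0_norm_le => x.
apply: (net_sum_norm_le (@sum_op_valP h x)); exists fset0 => B _.
exact: le_trans (ler_norm_sum _ _ _) (sum_op_bounded h x B).
Qed.

Definition sum_op : 'B(H, C0) := mk_bop sum_op_linear sum_op_bound.

Lemma unit_sqsum (i : I) A : sqsum (fun j => (j == i)%:R : K) A <= 1.
Proof.
have E j : modulus ((j == i)%:R : K) ^+ 2 = (j == i)%:R.
  case: (j == i); last by rewrite modulus0 expr0n.
  by rewrite -(of_real1 R k) of_realK ?ler01// expr1n.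
rewrite /sqsum; under eq_bigr do rewrite E.
by apply: sum_indicator_le1 => j j' _ _ /eqP-> /eqP.
Qed.

Definition unit_l2 (i : I) : H := mkL2 (unit_sqsum i).

Lemma sum_op_unit i : sum_op (unit_l2 i) = phi i.
Proof.
apply: C0_ext => x; apply: (net_sum_unique (@sum_op_valP (unit_l2 i) x)).
apply/net_sumP => e e0; exists [fset i]%fset => B iB.
rewrite (big_fsetD1 i) /=; last by rewrite -fsub1set.
rewrite eqxx mul1r big_seq big1 ?addr0 ?subrr ?normr0// => j.
by rewrite !inE => /andP[/negbTE-> _]; rewrite mul0r.
Qed.

End SumOperator.

(** The indices are distinct on [b], so the sum is dominated by 1/2 + 1/4 + ... = 1; induction on a
    bound [N] for the indices splits off the at most one term of index [N]. *)
Lemma sum_geometric_le1 (K : numFieldType) (I : choiceType) (A : {fset I})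
    (b : I -> bool) (j : I -> nat) :
  (forall y z, b y -> b z -> j y = j z -> y = z) ->
  \sum_(y <- A) (b y)%:R * 2^-1 ^+ (j y).+1 <= 1 :> K.
Proof.
move=> jinj.
have claim N : \sum_(y <- A) (b y && (j y < N)%N)%:R * 2^-1 ^+ (j y).+1 <= 1 - 2^-1 ^+ N :> K.
  elim: N => [|N IH].
    rewrite expr0 subrr big1// => y _; by rewrite andbF mul0r.
  have -> : \sum_(y <- A) (b y && (j y < N.+1)%N)%:R * 2^-1 ^+ (j y).+1 =
      \sum_(y <- A) (b y && (j y < N)%N)%:R * 2^-1 ^+ (j y).+1 +
      2^-1 ^+ N.+1 * \sum_(y <- A) (b y && (j y == N))%:R :> K.
    rewrite mulr_sumr -big_split; apply: eq_bigr => y _ /=.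
    rewrite ltnS leq_eqVlt; case: (b y) => /=; last by rewrite !mul0r mulr0 addr0.
    case: (eqVneq (j y) N) => [->|_] /=; first by rewrite ltnn mul0r add0r mulrC.
    by rewrite mulr0 addr0.
  have le1 : \sum_(y <- A) (b y && (j y == N))%:R <= 1 :> K.
    apply: sum_indicator_le1 => y z _ _ /andP[by' /eqP jy] /andP[bz /eqP jz].
    by apply: jinj => //; rewrite jy.
  apply: (@le_trans _ _ (1 - 2^-1 ^+ N + 2^-1 ^+ N.+1)).
    by rewrite lerD// ler_piMr// exprn_ge0// invr_ge0.
  have {1}-> : 2^-1 ^+ N = 2^-1 ^+ N.+1 + 2^-1 ^+ N.+1 :> K by rewrite exprSr -splitr.
  by rewrite opprD addrA subrK.
pose N := (\max_(y <- A) j y).+1.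
apply: (@le_trans _ _ (1 - 2^-1 ^+ N)); last by rewrite gerBl exprn_ge0// invr_ge0.
apply: le_trans (claim N); rewrite big_seq [leRHS]big_seq; apply: ler_sum => y yA.
have -> : (j y < N)%N by rewrite ltnS; exact: leq_bigmax_seq.
by rewrite andbT.
Qed.

Section KerSubHilbertGenerated.
Variables (R : realType) (k : scalars).
Local Notation K := (base_field R k).
Local Notation H := (l2 R k omega1).
Local Notation C0 := (C0_omega1 R k).
Local Notation W := omega1.
Variable D : set W.
Hypothesis cD : club D.

Definition gapless (z y : W) : bool :=
  (z <= y)%O && `[< forall d, D d -> (z <= d)%O -> (d <= y)%O -> False >].

Lemma gaplessP z y : reflect ((z <= y)%O /\
  forall d, D d -> (z <= d)%O -> (d <= y)%O -> False) (gapless z y).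
Proof. by apply: (iffP andP) => -[zy /asboolP]. Qed.

Lemma gap_left x : ~ D x -> exists o, ~~ below o x /\
  forall y, (y <= x)%O -> ~~ below o y -> ~ D y.
Proof.
move=> nDx; apply: contrapT => n; apply: nDx.
have /(closed_leftP omega1_min) := cD.1; apply => o ox.
apply: contrapT => ny; apply: n; exists o; split=> // y yx oy Dy.
by apply: ny; exists y.
Qed.

Lemma gap_continuous y : continuous (fun z : W => (gapless z y)%:R : K).
Proof.
move=> x; apply/(continuous_leftP omega1_min) => e e0.
suff [ o [ox oP]] : exists o, ~~ below o x /\ forall z, (z <= x)%O -> ~~ below o z ->
    gapless z y = gapless x y.
  by exists o; split=> // z zx oz; rewrite oP// subrr normr0.
have [xy|yx] := leP x y; last first.
  exists (Some y); rewrite /= -ltNge; split=> // z _; rewrite -ltNge => yz.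
  by rewrite /gapless !leNgt yz yx.
have [/gaplessP[_ g]|ng] := boolP (gapless x y).
  have [|o [ox oP]] := @gap_left x; first by move=> Dx; exact: (g x).
  exists o; split=> // z zx oz; apply/gaplessP; split; first exact: le_trans xy.
  move=> d Dd zd dy; have [dx|xd] := leP d x; last exact: (g d Dd (ltW xd)).
  by apply: (oP d) => //; apply: contra oz; apply: below_le.
exists None; split=> // z zx _; apply/negbTE/gaplessP => -[zy g].
move/gaplessP: ng; apply; split=> // d Dd xd; apply: g => //.
exact: le_trans xd.
Qed.

Lemma gap_vanish y : exists a, forall z, (a <= z)%O -> (gapless z y)%:R = 0 :> K.
Proof.
have [a ya] := omega1_gt y; exists a => z az.
by rewrite /gapless leNgt (lt_le_trans ya az).
Qed.

(** For [y] outside [D] this is the indicator of the part up to [y] of its gap; for [y] in [D] it is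
    the zero function. *)
Definition gap_ind (y : W) : C0 := mkC0 (@gap_continuous y) (gap_vanish y).

Lemma next_ex (y : W) : exists d, [/\ D d, (y <= d)%O &
  forall d', D d' -> (y <= d')%O -> (d <= d')%O].
Proof.
have [d Dd yd] := cD.2 y.
have [|m [Dm ym] mP] := @omega1_min [set d | D d /\ (y <= d)%O]; first by exists d.
by exists m; split=> // d' Dd' yd'; apply: mP.
Qed.

Definition next (y : W) : W := sval (cid (next_ex y)).

Lemma nextP y : [/\ D (next y), (y <= next y)%O &
  forall d', D d' -> (y <= d')%O -> (next y <= d')%O].
Proof. exact: (svalP (cid (next_ex y))). Qed.

Lemma gapless_next z y : gapless z y -> next y = next z.
Proof.
move=> /gaplessP[zy g]; have [Dy yy ymin] := nextP y; have [Dz zz zmin] := nextP z.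
apply/le_anti; rewrite zmin ?(le_trans zy)// andbT ymin//.
by rewrite leNgt; apply/negP => /ltW; exact: g.
Qed.

Lemma index_ex (d : W) : exists j : W -> nat, {in [set y | (y <= d)%O] &, injective j}.
Proof. exact/countable_injP/omega1_countable_le. Qed.

(** Points of one gap share [next], hence one injection of the countable segment up to [next] into
    [nat]. Indices are thus distinct within a gap, and only the gap of [x] contributes to the sum at
    [x]. *)
Definition gap_index (y : W) : nat := sval (cid (index_ex (next y))) y.

Definition gap_weight (y : W) : K := 2^-1 ^+ (gap_index y).+1.

Definition gap_family (y : W) : C0 := gap_weight y *: gap_ind y.

Lemma gap_family_le1 x (A : {fset W}) : \sum_(y <- A) `|gap_family y x| <= 1.
Proof.
have w0 y : 0 <= gap_weight y by rewrite exprn_ge0// invr_ge0.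
have E y : `|gap_family y x| = (gapless x y)%:R * 2^-1 ^+ (gap_index y).+1.
  rewrite -[gap_family y x]/(gap_weight y * (gapless x y)%:R) normrM.
  by rewrite normr_nat ger0_norm// mulrC.
under eq_bigr do rewrite E; apply: sum_geometric_le1 => y z gy gz.
rewrite /gap_index (gapless_next gy) (gapless_next gz).
have := svalP (cid (index_ex (next x))); move: (sval _) => j jinj.
have le_next t : gapless x t -> (t <= next x)%O.
  by move=> gt; rewrite -(gapless_next gt); have [] := nextP t.
by apply: jinj; rewrite inE /= le_next.
Qed.

Definition gap_op : 'B(H, C0) := sum_op gap_family_le1.

Definition gap_unit (y : W) : H := (gap_weight y)^-1 *: unit_l2 R k y.

Lemma gap_op_unit y : gap_op (gap_unit y) = gap_ind y.
Proof.
have -> : gap_op (gap_unit y) = (gap_weight y)^-1 *: gap_op (unit_l2 R k y) by exact: linearZ.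
rewrite /gap_op sum_op_unit /gap_family scalerA mulVf ?scale1r//.
by rewrite expf_neq0// invr_eq0 pnatr_eq0.
Qed.

(** Induction on [x] with approximation up to [x] and vanishing of [gap_op h] beyond [x]; the
    vanishing lets a new piece be added without disturbing earlier ones. At [x] in [D], [f] is
    already small on a left neighbourhood, so the earlier [h] still works. *)
Lemma gap_op_dense (f : C0) e : 0 < e -> (forall d, D d -> f d = 0) ->
  exists h, `|f - gap_op h| <= e.
Proof.
move=> e0 fD; have g0 : gap_op 0 = 0 by exact: linear0.
have P x : exists h, (forall z, (z <= x)%O -> `|f z - gap_op h z| <= e) /\
    forall z, (x < z)%O -> gap_op h z = 0.
  elim/(wf_ind omega1_min): x => x IH.
  have {}IH o : ~~ below o x -> exists h, (forall z, below o z -> `|f z - gap_op h z| <= e) /\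
      forall z, ~~ below o z -> gap_op h z = 0.
    case: o => [a|_]; last by exists 0; split=> // z _; rewrite g0.
    rewrite [below _ _]/= -ltNge => /IH[h [h1 h2]]; exists h; split=> // z.
    by rewrite [below _ _]/= -ltNge; exact: h2.
  have /(continuous_leftP omega1_min)/(_ _ e0)[ o1 [ox1 o1P]] := @C0_continuous _ _ f x.
  have [Dx|nDx] := pselect (D x).
    have [h [h1 h2]] := IH _ ox1; exists h; split=> z zx.
      case oz : (below o1 z); first exact: h1.
      rewrite h2 ?oz// subr0 -normrN -[- f z]add0r -(fD x Dx) ltW//.
      by rewrite o1P// oz.
    by apply: h2; apply: contra ox1; apply: below_le; exact: ltW.
  have [ o2 [ox2 o2P]] := gap_left nDx.
  have [ o oP] := below_max o1 o2.
  have ox : ~~ below o x by rewrite oP negb_or ox1.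
  have [h [h1 h2]] := IH _ ox.
  (* As (o, x] misses [D], removing the part of the gap up to [a] from the part up to [x] leaves
     exactly (a, x]. When [o] is [None], all of [0, x] lies in the gap. *)
  pose v := gap_unit x - (if o is Some a then gap_unit a else 0).
  have vE z : gap_op v z = ((z <= x)%O && ~~ below o z)%:R.
    have gx : gapless z x =
        (if o is Some a then gapless z a else false) || ((z <= x)%O && ~~ below o z).
      have noD d : D d -> (d <= x)%O -> below o d.
        move=> Dd dx; apply: contrapT => /negP; rewrite oP negb_or => /andP[_ od].
        exact: (o2P d).
      apply/idP/orP => [/gaplessP[zx g]|[|/andP[zx oz]]].
      - rewrite zx /=; case: (o) ox noD => [a|] /=; last by right.
        rewrite -ltNge => ax noD; have [za|] := leP z a; last by right.
        left; apply/gaplessP; split=> // d Dd zd da.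
        exact: (g d Dd zd (le_trans da (ltW ax))).
      - case: (o) ox noD => [a|] //=; rewrite -ltNge => ax noD /gaplessP[za g].
        apply/gaplessP; split; first exact: le_trans za (ltW ax).
        by move=> d Dd zd /(noD d Dd); exact: g.
      - apply/gaplessP; split=> // d Dd zd /(noD d Dd) od.
        by move/negP: oz; apply; exact: below_le od.
    have -> : gap_op v z = gap_ind x z - (if o is Some a then gapless z a else false)%:R.
      rewrite /v linearB -[LHS]/(gap_op (gap_unit x) z - gap_op _ z) gap_op_unit.
      by congr (_ - _); case: (o) => [a|]; rewrite ?gap_op_unit ?g0.
    rewrite -[gap_ind x z]/((gapless z x)%:R : K) gx.
    case: (o) ox => [a|] /=; last by rewrite subr0.
    rewrite -ltNge => ax; rewrite -ltNge.
    case: (boolP (gapless z a)) => [/gaplessP[za _]|_] /=.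
      by rewrite ltNge za andbF subrr.
    by rewrite subr0.
  exists (h + f x *: v).
  have E z : gap_op (h + f x *: v) z = gap_op h z + f x * gap_op v z.
    by rewrite linearD linearZ.
  split=> z zx; rewrite E vE.
    rewrite zx andTb; case oz : (below o z); first by rewrite mulr0 addr0 h1.
    rewrite h2 ?oz// mulr1 add0r distrC ltW// o1P//.
    by apply: contraFN oz => oz; rewrite oP oz.
  rewrite h2; last by apply: contra ox; apply: below_le; exact: ltW.
  by rewrite leNgt zx mulr0 addr0.
have [a fa] := C0_vanish f; have [h [h1 h2]] := P a; exists h.
apply: C0_norm_le => z; have [/h1//|az] := leP z a.
by rewrite -[(f - _) z]/(f z - gap_op h z) fa ?h2// ?subr0 ?normr0 ?ltW.
Qed.

End KerSubHilbertGenerated.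

Lemma ker_sub_hilbert_generated (R : realType) (k : scalars)
    (T : 'B(C0_omega1 R k)) :
  ab_character T = 0 -> hilbert_generated (C0_omega1 R k) (C0_omega1 R k) T.
Proof.
move=> T0; have [D [cD TD]] := ab_characterP T.
exists (l2 R k omega1); split; first exact: l2_hilbert_norm.
exists (gap_op R k cD) => _ [f _ <-] B /nbhs_ballP[e /= e0 eB].
have e2 : 0 < e / 2 by rewrite divr_gt0.
have [|h hT] := gap_op_dense cD (f := T f) e2.
  by move=> d Dd; rewrite TD// T0 mul0r.
exists (gap_op R k cD h); split; first by exists h.
apply: eB; rewrite -ball_normE /=; apply: le_lt_trans hT _.
by rewrite ltr_pdivrMr// ltr_pMr// ltr1n.
Qed.

Theorem corollary4p5 (R : realType) (k : scalars) :
  [/\ loy_willis R k = [set T | ab_character T = 0],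
      loy_willis R k = hilbert_generated (C0_omega1 R k) (C0_omega1 R k),
      maximal_ideal (loy_willis R k) &
      forall I, maximal_ideal I -> I = loy_willis R k].
Proof.
rewrite loy_willisE; split=> //.
- apply/seteqP; split=> T; first exact: ker_sub_hilbert_generated.
  exact: hilbert_generated_sub_ker.
- exact: maximal_ideal_ker.
- exact: maximal_ideal_unique.
Qed.
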